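(* Let $R$ be an associative ring with identity such that $\mathcal{I}(R)\subseteq\mathcal{F}(R)^{\wedge}$ and $\mathrm{silp}(R):=\mathrm{id}(\mathcal{P}(R))<\infty$. Then: (i) $\mathrm{silp}(R)=\mathrm{spli}(R)$. (ii) If additionally $R$ is an Artin algebra, then the Gorenstein Symmetry Conjecture holds for $R$, i.e. the injective dimension of $R$ as a left $R$-module equals the injective dimension of $R$ as a right $R$-module.
   Context: Modules are left $R$-modules unless specified; $\mathcal{P}(R)$, $\mathcal{I}(R)$, $\mathcal{F}(R)$ are the classes of projective, injective and flat left $R$-modules. $\mathrm{silp}(R)=\mathrm{id}(\mathcal{P}(R)):=\sup\{\mathrm{id}(P):P\in\mathcal{P}(R)\}$ and $\mathrm{spli}(R)=\mathrm{pd}(\mathcal{I}(R)):=\sup\{\mathrm{pd}(I):I\in\mathcal{I}(R)\}$. $\mathcal{F}(R)^{\wedge}$ is the class of modules $M$ for which there exist $m\ge0$ and an exact sequence $0\to F_m\to\cdots\to F_0\to M\to0$ with all $F_i$ flat, i.e. the modules of finite flat dimension. The Gorenstein Symmetry Conjecture states that for an Artin algebra the left and the right injective dimensions of the regular module coincide. *)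

(* Defs.v *)
From HB Require Import structures.
From mathcomp Require Import all_boot all_algebra.
From mathcomp Require Import boolp.
From mathcomp.multinomials Require Import freeg.

Set Implicit Arguments.
Unset Strict Implicit.
Unset Printing Implicit Defensive.

Import GRing.Theory.
Local Open Scope ring_scope.
Local Open Scope quotient_scope.

(* Values of homological dimensions: [Some n] is the natural number [n] and
   [None] is infinity. *)
Notation dimension := (option nat).

Definition dim_le (d : dimension) (n : nat) : Prop :=
  if d is Some k then (k <= n)%N else False.

Definition least (P : nat -> Prop) : dimension :=
  if pselect (exists n, `[< P n >]) is left exP then Some (ex_minn exP)
  else None.

Lemma leastP (P : nat -> Prop) n :
  least P = Some n <-> P n /\ forall m, P m -> (n <= m)%N.
Proof.
rewrite /least; case: pselect => [exP|nexP].
  case: ex_minnP => k /asboolP Pk mink.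
  split=> [[<-]|[Pn minn]].
    by split=> // m Pm; apply/mink/asboolP.
  congr Some; apply/eqP; rewrite eqn_leq minn // andbT.
  exact/mink/asboolP.
by split=> // -[Pn _]; case: nexP; exists n; apply/asboolP.
Qed.

(* Supremum in the natural numbers extended with infinity. *)
Definition dim_sup (S : dimension -> Prop) : dimension :=
  least (fun n => forall d, S d -> dim_le d n).

(* A right R-module is a left module over the converse ring R^c, the right
   action of r on a being [(r : R^c) *: a].  The tensor product A (x)_R M is
   the quotient of the free abelian group on A * M by the subgroup
   [balanced]. *)
Section Tensor.

Variables (R : pzRingType) (M : lmodType R).

Section Object.

Variable A : lmodType R^c.

Inductive balanced : {freeg (A * M)%type} -> Prop :=
  | balanced_addl a a' m :
      balanced (<< (a + a', m) >> - (<< (a, m) >> + << (a', m) >>))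
  | balanced_addr a m m' :
      balanced (<< (a, m + m') >> - (<< (a, m) >> + << (a, m') >>))
  | balanced_scale a (r : R) m :
      balanced (<< ((r : R^c) *: a, m) >> - << (a, r *: m) >>)
  | balanced0 : balanced 0
  | balancedB x y : balanced x -> balanced y -> balanced (x - y).

Definition balancedb : {pred {freeg (A * M)%type}} :=
  fun x => `[< balanced x >].

Lemma balancedb_zmod_closed : zmod_closed balancedb.
Proof.
split=> [|x y /asboolP bx /asboolP b_y]; first exact/asboolP/balanced0.
exact/asboolP/balancedB.
Qed.

HB.instance Definition _ :=
  GRing.isZmodClosed.Build _ balancedb balancedb_zmod_closed.

Definition tensor : zmodType := {ideal_quot balancedb}.

Definition tensor_pi (x : {freeg (A * M)%type}) : tensor :=
  \pi_{ideal_quot balancedb} x.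

Definition tens (a : A) (m : M) : tensor := tensor_pi << (a, m) >>.

Lemma tensor_pi_is_additive : zmod_morphism tensor_pi.
Proof. by move=> x y; rewrite /tensor_pi !piE. Qed.

HB.instance Definition _ :=
  GRing.isZmodMorphism.Build _ _ tensor_pi tensor_pi_is_additive.

Lemma tensor_piP x y : tensor_pi x = tensor_pi y <-> balanced (x - y).
Proof.
split=> [/eqP e|/asboolP b].
  by apply/asboolP; rewrite -[asbool _]/(x - y \in balancedb) Quotient.idealrBE.
by apply/eqP; rewrite /tensor_pi -Quotient.idealrBE.
Qed.

End Object.

Variables (A B : lmodType R^c) (f : {linear A -> B}).

Definition free_map : {freeg (A * M)%type} -> {freeg (B * M)%type} :=
  fglift (fun am => << (f am.1, am.2) >>).

(* The homomorphism f (x) id_M; see [tensor_map_tens]. *)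
Definition tensor_map (t : tensor A) : tensor B :=
  tensor_pi (free_map (repr (t : {ideal_quot @balancedb A}))).

Lemma free_mapU a m : free_map << (a, m) >> = << (f a, m) >>.
Proof. by rewrite /free_map liftU scale1r. Qed.

Lemma free_mapB : {morph free_map : x y / x - y}.
Proof. exact: lift_is_additive. Qed.

Lemma balanced_free_map x : balanced x -> balanced (free_map x).
Proof.
have free_mapN y : free_map (- y) = - free_map y.
  by rewrite -[- y]sub0r free_mapB -[in free_map 0](subrr y) free_mapB subrr sub0r.
have free_mapD y z : free_map (y + z) = free_map y + free_map z.
  by rewrite -[z in LHS]opprK free_mapB free_mapN opprK.
elim=> [a a' m|a m m'|a r m||y z _ by_ _ bz].
- rewrite free_mapB free_mapD !free_mapU linearD; exact: balanced_addl.
- rewrite free_mapB free_mapD !free_mapU; exact: balanced_addr.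
- rewrite free_mapB !free_mapU linearZ; exact: balanced_scale.
- by rewrite -(subrr 0) free_mapB subrr; exact: balanced0.
- by rewrite free_mapB; exact: balancedB.
Qed.

Lemma tensor_map_pi x : tensor_map (tensor_pi x) = tensor_pi (free_map x).
Proof.
apply/tensor_piP; rewrite -free_mapB; apply/balanced_free_map/tensor_piP.
exact: reprK.
Qed.

Lemma tensor_map_tens a m : tensor_map (tens a m) = tens (f a) m.
Proof. by rewrite tensor_map_pi free_mapU. Qed.

Lemma tensor_map_is_additive : zmod_morphism tensor_map.
Proof.
move=> s t; rewrite -[s](@reprK _ {ideal_quot @balancedb A}).
rewrite -[t](@reprK _ {ideal_quot @balancedb A}).
rewrite -!/(tensor_pi _) -tensor_pi_is_additive !tensor_map_pi free_mapB.
exact: tensor_pi_is_additive.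
Qed.

HB.instance Definition _ :=
  GRing.isZmodMorphism.Build _ _ tensor_map tensor_map_is_additive.

End Tensor.

Section Modules.

Variable R : pzRingType.
Implicit Types (M P E : lmodType R) (C : lmodType R -> Prop).

Definition surj (T U : Type) (f : T -> U) : Prop := forall y, exists x, f x = y.

Definition projective P : Prop :=
  forall (A B : lmodType R) (p : {linear A -> B}) (g : {linear P -> B}),
    surj p -> exists h : {linear P -> A}, forall x, p (h x) = g x.

Definition injective_module E : Prop :=
  forall (A B : lmodType R) (i : {linear A -> B}) (g : {linear A -> E}),
    injective i -> exists h : {linear B -> E}, forall x, h (i x) = g x.

Definition flat M : Prop :=
  forall (A B : lmodType R^c) (f : {linear A -> B}),
    injective f -> injective (@tensor_map R M A B f).

Definition exact_at (U V W : lmodType R)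
    (f : {linear U -> V}) (g : {linear V -> W}) : Prop :=
  forall y, g y = 0 <-> exists x, f x = y.

(* An exact sequence 0 -> F_n -> ... -> F_0 -> M -> 0 with all F_i in C, the
   family F being extended by zero modules above n. *)
Definition resolution C M (n : nat) : Prop :=
  exists (F : nat -> lmodType R) (d : forall i, {linear F i.+1 -> F i})
         (e : {linear F 0%N -> M}),
    [/\ surj e, exact_at (d 0%N) e & forall i, exact_at (d i.+1) (d i)] /\
    (forall i, (i <= n)%N -> C (F i)) /\
    (forall i, (n < i)%N -> forall x : F i, x = 0).

(* An exact sequence 0 -> M -> F_0 -> ... -> F_n -> 0 with all F_i in C. *)
Definition coresolution C M (n : nat) : Prop :=
  exists (F : nat -> lmodType R) (d : forall i, {linear F i -> F i.+1})
         (e : {linear M -> F 0%N}),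
    [/\ injective e, exact_at e (d 0%N) & forall i, exact_at (d i) (d i.+1)] /\
    (forall i, (i <= n)%N -> C (F i)) /\
    (forall i, (n < i)%N -> forall x : F i, x = 0).

Definition proj_dim M : dimension := least (resolution projective M).

Definition inj_dim M : dimension := least (coresolution injective_module M).

Definition finite_flat_dim M : Prop := exists m, resolution flat M m.

End Modules.

Definition silp (R : pzRingType) : dimension :=
  dim_sup (fun d => exists P : lmodType R, projective P /\ d = inj_dim P).

Definition spli (R : pzRingType) : dimension :=
  dim_sup (fun d => exists E : lmodType R, injective_module E /\ d = proj_dim E).

Definition is_ideal (k : comPzRingType) (I : k -> Prop) : Prop :=
  [/\ I 0, forall x y, I x -> I y -> I (x + y)
    & forall a x, I x -> I (a * x)].

Definition artinian (k : comPzRingType) : Prop :=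
  forall I : nat -> k -> Prop,
    (forall n, is_ideal (I n)) -> (forall n x, I n.+1 x -> I n x) ->
    exists n, forall m, (n <= m)%N -> forall x, I m x <-> I n x.

Definition artin_algebra (R : pzRingType) : Prop :=
  exists (k : comPzRingType) (phi : {rmorphism k -> R}),
    [/\ artinian k,
        forall a x, phi a * x = x * phi a
      & exists (n : nat) (g : 'I_n -> R),
          forall x, exists c : 'I_n -> k, x = \sum_i phi (c i) * g i].

(* The Gorenstein symmetry property: the left and the right injective dimension
   of R coincide.  The regular right module is the regular left module over R^c. *)
Definition gorenstein_symmetry (R : pzRingType) : Prop :=
  @inj_dim R R^o = @inj_dim R^c (R^c)^o.

(* Main.v *)
From HB Require Import structures.
From mathcomp Require Import all_boot all_algebra.
From mathcomp Require Import boolp classical_sets functions wochoice ring.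
From mathcomp.multinomials Require Import freeg.
Require Import Defs.

(** Let n = silp R be finite.

    Part (i). A module M of finite projective dimension has projective
    dimension at most n: if its syzygy of order k + 1 > n is projective, then
    that syzygy has injective dimension at most n <= k, so the last map of the
    resolution splits and already the syzygy of order k is projective
    ([silp_pd_le]). As Jensen observed, this bound extends to flat modules
    ([flat_pd_le]). An injective module of finite flat dimension has a flat
    syzygy; so it has finite projective dimension, hence projective dimension
    at most n, and spli R <= silp R. The dual splitting argument gives silp R
    <= spli R ([spli_id_le]).

    Jensen's theorem. Write a flat module as P / K with P free. Then K is pure
    in P: each finite part of K is fixed by a homomorphism P -> K with finitely
    generated image ([flat_pure]). After a choice of such homomorphisms every
    subset of K has a pure hull. The hull of a finite set is countably
    generated, hence projective ([telescope_projective]). Well-order K; by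
    transfinite induction the hull of an initial segment together with a finite
    set has projective dimension at most n. Indeed these hulls form a
    continuous chain, and the quotient U' / U of two of its members is the
    kernel of P / U -> P / U'; by induction both quotients of P have finite
    projective dimension, so U' / U has projective dimension at most n by the
    remark above ([subquot_pd_le]). By the lemma of Auslander and Eklof the
    bound passes from these quotients to the union of the chain
    ([good_initial]).

    Part (ii). An Artin algebra is noetherian on both sides. Let S be the
    opposite ring, and let M^+ = Hom(M, Q/Z), which exchanges R-modules and
    S-modules. Three facts about noetherian rings are used: silp is the
    injective dimension of the regular module ([silp_regular]); M and M^++ have
    the same injective dimension ([bidual_id_le]); and Ext_R(B, X^+), Ext_S(X,
    B^+) vanish together, both being dual to Tor ([ext_zero_chr]). Since S^+ is
    an injective R-module, its projective dimension is at most spli R = silp R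
    = id R; therefore id S = id S^++ <= id R ([spli_id_le_opposite]). To
    exchange the sides, observe that S inherits the hypotheses: silp S = id S
    is finite, and an injective S-module is a direct summand of F^+ for a free
    R-module F, where id F^++ = id F <= n bounds the flat dimension of F^+
    ([silp_injective_fd]).

    Conventions: [ext_zero k M N] says that Ext^(k+1)(M, N) vanishes, [pd_le]
    and [id_le] bound projective and injective dimensions, and a flat dimension
    at most m is expressed as an injective dimension at most m of the character
    module. *)

Set Implicit Arguments.
Unset Strict Implicit.
Unset Printing Implicit Defensive.

Import GRing.Theory Num.Theory.
Local Open Scope ring_scope.
Local Open Scope quotient_scope.

(** * Linear maps, submodules and quotients *)

Section LinearRel.
Variables (R : pzRingType) (A B : lmodType R).

Section Bundle.
Variables (f : A -> B) (lin_f : linear f).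
HB.instance Definition _ := GRing.isLinear.Build R A B *:%R f lin_f.
Definition linear_of : {linear A -> B} := f.
End Bundle.

(** Homomorphisms are constructed from their graphs: choice turns a functional
    linear relation into a map, and well-definedness reduces to the value at 0.
    *)
Lemma linear_rel (G : A -> B -> Prop) :
  (forall a x y x' y', G x y -> G x' y' -> G (a *: x + x') (a *: y + y')) ->
  (forall x, exists y, G x y) -> (forall y, G 0 y -> y = 0) ->
  exists f : {linear A -> B}, forall x, G x (f x).
Proof.
move=> linG totG sgG; have [f fP] := choice totG.
have GB x y y' : G x y -> G x y' -> y = y'.
  move=> Gy Gy'; apply/eqP; rewrite -subr_eq0 addrC -scaleN1r; apply/eqP/sgG.
  by rewrite -(addNr x) -scaleN1r; apply: linG.
have lin_f : linear f.
  by move=> a x y; apply: (@GB (a *: x + y)) => //; apply: linG.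
by exists (linear_of lin_f).
Qed.

End LinearRel.

Section Factor.
Variables (R : pzRingType) (A B C : lmodType R).

Definition lin_comp (g : {linear B -> C}) (f : {linear A -> B}) :
  {linear A -> C} :=
  linear_of (linearP (g \o f)).

Lemma factor_surj (q : {linear A -> B}) (g : {linear A -> C}) :
  surj q -> (forall x, q x = 0 -> g x = 0) ->
  exists h : {linear B -> C}, forall x, h (q x) = g x.
Proof.
move=> sq kq.
suff [h hP] : exists h : {linear B -> C}, forall y, exists2 x, q x = y
  & g x = h y.
  exists h => x; have [x' qx' <-] := hP (q x).
  by apply/eqP; rewrite -subr_eq0 -linearB kq // linearB qx' subrr.
apply: (@linear_rel R B C (fun y z => exists2 x, q x = y & g x = z)) =>
  [a y z y' z' [x <- <-] [x' <- <-]|y|z [x /kq -> ->//]].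
  by exists (a *: x + x'); rewrite linearP.
by have [x <-] := sq y; exists (g x), x.
Qed.

Lemma factor_inj (i : {linear A -> B}) (g : {linear C -> B}) :
  injective i -> (forall x, exists y, i y = g x) ->
  exists h : {linear C -> A}, forall x, i (h x) = g x.
Proof.
move=> inji im; apply: (@linear_rel R C A (fun x y => i y = g x)) =>
  [a x y x' y' e e'|//|y].
  by rewrite !linearP e e'.
by rewrite linear0 => e; apply: inji; rewrite e linear0.
Qed.

End Factor.

Section Submodules.
Variables (R : pzRingType) (M : lmodType R).

(** Submodules are predicates in Prop, since membership is undecidable in
    general; [subm] and [quom] turn them into modules. *)
Record submodule := Submodule {
  in_sub :> M -> Prop;
  in_sub0 : in_sub 0;
  in_subP : forall a x y, in_sub x -> in_sub y -> in_sub (a *: x + y) }.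

Variable D : submodule.

Lemma in_subD x y : D x -> D y -> D (x + y).
Proof. by rewrite -[x in D (x + y)]scale1r; apply: in_subP. Qed.

Lemma in_subZ a x : D x -> D (a *: x).
Proof. by rewrite -[a *: x]addr0 => Dx; apply: in_subP Dx (in_sub0 _). Qed.

Lemma in_subN x : D x -> D (- x).
Proof. by rewrite -scaleN1r; apply: in_subZ. Qed.

Lemma in_subB x y : D x -> D y -> D (x - y).
Proof. by move=> Dx Dy; apply: in_subD => //; apply: in_subN. Qed.

Lemma in_sub_sum I (r : seq I) (P : pred I) (F : I -> M) :
  (forall i, P i -> D (F i)) -> D (\sum_(i <- r | P i) F i).
Proof.
by move=> DF; elim/big_rec: _ => [|i x /DF]; [apply: in_sub0 | apply: in_subD].
Qed.

Definition sub_pred : {pred M} := fun x => `[<D x>].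

Lemma sub_pred_closed : submod_closed sub_pred.
Proof.
split=> [|a x y /asboolP Dx /asboolP Dy]; apply/asboolP; first exact: in_sub0.
exact: in_subP.
Qed.

HB.instance Definition _ := GRing.isSubmodClosed.Build R M sub_pred
   (GRing.submod_closed_semi sub_pred_closed).

Record submod := Submod_ { submod_val : M; _ : submod_val \in sub_pred }.

HB.instance Definition _ := [isSub for submod_val].
HB.instance Definition _ := [Choice of submod by <:].
HB.instance Definition _ := [SubChoice_isSubLmodule of submod by <:].

Definition subm : lmodType R := submod.

Fact incl_linear : linear (val : subm -> M). Proof. by []. Qed.
(** [incl], [proj] and [coef] are sealed behind their defining equations,
    because simplification would unfold them. *)
Fact incl_key : {i : {linear subm -> M} | i =1 val}.
Proof. by exists (linear_of incl_linear). Qed.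
Definition incl : {linear subm -> M} := sval incl_key.

Fact inclE x : incl x = val x. Proof. exact: (svalP incl_key). Qed.

Lemma incl_inj : injective incl. Proof. by move=> x y; rewrite !inclE;
  apply: val_inj. Qed.

Lemma inclP x : D (incl x). Proof. by rewrite inclE;
  apply/asboolP/(valP x). Qed.

Lemma incl_onto x : D x -> exists y, incl y = x.
Proof. by move=> /asboolP Dx; exists (Submod_ Dx); rewrite inclE. Qed.

Lemma corestrict (A : lmodType R) (f : {linear A -> M}) : (forall x, D (f x)) ->
  exists g : {linear A -> subm}, forall x, incl (g x) = f x.
Proof.
by move=> Df; apply: factor_inj => [|x]; [exact: incl_inj|exact: incl_onto].
Qed.

Definition quot := {ideal_quot sub_pred}.
HB.instance Definition _ := GRing.Zmodule.on quot.

Definition quot_pi (x : M) : quot := \pi_{ideal_quot sub_pred} x.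

Lemma quot_pi_eq x y : quot_pi x = quot_pi y <-> D (x - y).
Proof.
split=> [/eqP|/asboolP Dxy].
  by rewrite /quot_pi -Quotient.idealrBE => /asboolP.
by apply/eqP; rewrite /quot_pi -Quotient.idealrBE.
Qed.

Lemma quot_piD x y : quot_pi (x + y) = quot_pi x + quot_pi y.
Proof. by rewrite /quot_pi !piE. Qed.

Lemma quot_surj : surj quot_pi.
Proof. by move=> y; exists (repr y); apply: reprK. Qed.

Definition quot_scale (a : R) (y : quot) : quot := quot_pi (a *: repr y).

Lemma quot_scaleE a x : quot_scale a (quot_pi x) = quot_pi (a *: x).
Proof.
apply/quot_pi_eq; rewrite -scalerBr; apply: in_subZ; apply/quot_pi_eq.
exact: reprK.
Qed.

Lemma quot_scaleA a b y : quot_scale a (quot_scale b y) = quot_scale (a * b) y.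
Proof. by have [x <-] := quot_surj y; rewrite !quot_scaleE scalerA. Qed.

Lemma quot_scale1 : left_id 1 quot_scale.
Proof. by move=> y; have [x <-] := quot_surj y;
  rewrite quot_scaleE scale1r. Qed.

Lemma quot_scaleDr : right_distributive quot_scale +%R.
Proof.
move=> a y z; have [x <-] := quot_surj y; have [x' <-] := quot_surj z.
by rewrite -quot_piD !quot_scaleE scalerDr quot_piD.
Qed.

Lemma quot_scaleDl y : {morph quot_scale^~ y : a b / a + b}.
Proof.
by move=> a b; have [x <-] := quot_surj y;
  rewrite !quot_scaleE scalerDl quot_piD.
Qed.

HB.instance Definition _ := GRing.Zmodule_isLmodule.Build R quot
  quot_scaleA quot_scale1 quot_scaleDr quot_scaleDl.

Definition quom : lmodType R := quot.

Lemma quot_pi_linear : linear (quot_pi : M -> quom).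
Proof. by move=> a x y; rewrite quot_piD -quot_scaleE. Qed.

Fact proj_key : {p : {linear M -> quom} | p =1 quot_pi}.
Proof. by exists (linear_of quot_pi_linear). Qed.
Definition proj : {linear M -> quom} := sval proj_key.

Fact projE x : proj x = quot_pi x. Proof. exact: (svalP proj_key). Qed.

Lemma proj_surj : surj proj. Proof. by move=> y; have [x] := quot_surj y;
  rewrite -projE; exists x. Qed.

Lemma proj_eq0 x : proj x = 0 <-> D x.
Proof.
by rewrite -[0](linear0 proj) -{2}[x]subr0 !projE; apply: quot_pi_eq.
Qed.

End Submodules.

Arguments incl {R M D}.
Arguments proj {R M} D.
Arguments proj_surj {R M} D y.

(** * Direct sums, free modules and extension of partial homomorphisms *)

Section Kernels.
Variables (R : pzRingType) (A B : lmodType R) (f : {linear A -> B}).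

Fact ker0 : f 0 = 0. Proof. exact: linear0. Qed.
Fact kerP a x y : f x = 0 -> f y = 0 -> f (a *: x + y) = 0.
Proof. by move=> fx fy; rewrite linearP fx fy scaler0 addr0. Qed.
Definition ker_sub := Submodule ker0 kerP.

Fact im0 : exists x, f x = 0. Proof. by exists 0; apply: linear0. Qed.
Fact imP a y z :
  (exists x, f x = y) -> (exists x, f x = z) -> exists x, f x = a *: y + z.
Proof. by move=> [x <-] [x' <-]; exists (a *: x + x'); rewrite linearP. Qed.
Definition im_sub := Submodule im0 imP.

Variable D : submodule B.
Fact preim0 : D (f 0). Proof. by rewrite linear0; apply: in_sub0. Qed.
Fact preimP a x y : D (f x) -> D (f y) -> D (f (a *: x + y)).
Proof. by rewrite linearP; apply: in_subP. Qed.
Definition preim_sub := Submodule preim0 preimP.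

Lemma inj_linear : (forall x, f x = 0 -> x = 0) -> injective f.
Proof.
move=> kf x y e; apply/eqP; rewrite -subr_eq0; apply/eqP/kf.
by rewrite linearB e subrr.
Qed.

End Kernels.

Section Span.
Variables (R : pzRingType) (M : lmodType R) (X : M -> Prop).

Definition in_span x := forall D : submodule M, (forall y, X y -> D y) -> D x.
Fact span0 : in_span 0. Proof. by move=> D _; apply: in_sub0. Qed.
Fact spanP a x y : in_span x -> in_span y -> in_span (a *: x + y).
Proof. by move=> sx sy D XD; apply: in_subP; [apply: sx|apply: sy]. Qed.
Definition span := Submodule span0 spanP.

Lemma span_min (D : submodule M) :
  (forall y, X y -> D y) -> forall x, span x -> D x.
Proof. by move=> XD x; apply. Qed.

Lemma span_gen x : X x -> span x. Proof. by move=> Xx D; apply. Qed.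
End Span.

Lemma span_mono (R : pzRingType) (M : lmodType R) (X Y : M -> Prop) :
  (forall x, X x -> Y x) -> forall x, span X x -> span Y x.
Proof. by move=> XY x; apply: span_min => y /XY; apply: span_gen. Qed.

Lemma span_eq (R : pzRingType) (M N : lmodType R) (X : M -> Prop)
    (f g : {linear M -> N}) :
  (forall x, X x -> f x = g x) -> forall x, span X x -> f x = g x.
Proof.
move=> fg x; suff Dlin a y z : f y = g y -> f z = g z ->
    f (a *: y + z) = g (a *: y + z).
  have D0 : f 0 = g 0 by rewrite !linear0.
  exact: (@span_min _ _ X (Submodule D0 Dlin)).
by move=> e e'; rewrite !linearP e e'.
Qed.

Section DirectSum.
Variables (R : pzRingType) (X : choiceType) (V : lmodType R).

(** [dsum] is the direct sum of copies of V indexed by X, realized by functions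
    of finite support. *)
Definition fin_supp (f : X -> V) := exists s : seq X, forall x, x \notin s ->
  f x = 0.

Fact fin_supp0 : fin_supp 0. Proof. by exists [::]. Qed.
Fact fin_suppP a f g : fin_supp f -> fin_supp g -> fin_supp (a *: f + g).
Proof.
move=> [s sf] [t tg]; exists (s ++ t) => x; rewrite mem_cat negb_or.
move=> /andP[/sf fx /tg gx].
by rewrite -[LHS]/(a *: f x + g x) fx gx scaler0 addr0.
Qed.
Definition dsum : lmodType R := subm (Submodule fin_supp0 fin_suppP).

Fact coef_linear x : linear (fun f : dsum => incl f x).
Proof. by move=> a f g; rewrite linearP. Qed.
Fact coef_key x : {c : {linear dsum -> V} | forall f, c f = incl f x}.
Proof. by exists (linear_of (coef_linear x)). Qed.
Definition coef x : {linear dsum -> V} := sval (coef_key x).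

Lemma coefE x f : coef x f = incl f x. Proof. exact: (svalP (coef_key x)). Qed.

Lemma coef_inj f g : (forall x, coef x f = coef x g) -> f = g.
Proof. by move=> fg; apply: incl_inj; apply/funext => x; rewrite -!coefE. Qed.

Lemma dsum_supp (f : dsum) : exists2 s : seq X,
  uniq s & forall x, x \notin s -> coef x f = 0.
Proof.
have [s sf] := inclP f; exists (undup s) => [|x]; first exact: undup_uniq.
rewrite coefE.
by rewrite mem_undup => /sf.
Qed.

Lemma dsum_of (f : X -> V) : fin_supp f ->
  exists g : dsum, forall x, coef x g = f x.
Proof.
move=> ff; have [g gf] := incl_onto (D := Submodule fin_supp0 fin_suppP) ff.
by exists g => x; rewrite coefE gf.
Qed.

Lemma dsingle_ex x : exists h : {linear V -> dsum},
  forall v y, coef y (h v) = if y == x then v else 0.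
Proof.
pose f (v : V) y := if y == x then v else 0.
have lf : linear f.
  move=> a v w; apply/funext => y; rewrite /f -[RHS]/(a *: f v y + f w y) /f.
  by case: eqP; rewrite // scaler0 addr0.
have [v|h hP] := corestrict (D := Submodule fin_supp0 fin_suppP)
    (f := linear_of lf).
  by exists [:: x] => y; rewrite inE /= /f => /negbTE->.
by exists h => v y; rewrite coefE hP.
Qed.

Definition dsingle x : {linear V -> dsum} := sval (cid (dsingle_ex x)).

Lemma coef_single x y v : coef y (dsingle x v) = if y == x then v else 0.
Proof. by rewrite /dsingle; case: cid. Qed.

Lemma dsum_decomp (f : dsum) s : uniq s ->
  (forall x, x \notin s -> coef x f = 0) ->
  f = \sum_(x <- s) dsingle x (coef x f).
Proof.
move=> us sf; apply: coef_inj => y; rewrite linear_sum.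
have [ys|/[dup] yns /sf ->] := boolP (y \in s); last first.
  rewrite big_seq big1 // => x xs; rewrite coef_single.
  by case: eqP => // yx; rewrite yx xs in yns.
rewrite (bigD1_seq y) //= coef_single eqxx big1 ?addr0 // => x.
by rewrite coef_single eq_sym => /negbTE->.
Qed.

Lemma dsum_univ (N : lmodType R) (g : X -> {linear V -> N}) :
  exists h : {linear dsum -> N}, forall x v, h (dsingle x v) = g x v.
Proof.
pose S t f := \sum_(x <- t) g x (coef x f).
pose G f n := exists s : seq X, forall t, uniq t -> {subset s <= t} ->
  n = S t f.
have GS (f : dsum) s : uniq s -> (forall x, x \notin s -> coef x f = 0) ->
  G f (S s f).
  move=> us sf; exists s => t ut st; rewrite /S [RHS](bigID (mem s)) /=.
  rewrite [X in _ + X]big1 ?addr0 => [|x /sf ->]; last exact: linear0.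
  rewrite -[RHS]big_filter; apply: perm_big; apply: uniq_perm => //.
    exact: filter_uniq.
  by move=> x; rewrite mem_filter; case: (boolP (x \in s)) => //= /st.
have [a f n f' n' [s sP] [s' sP']|f|n [s sP]|h hP] := @linear_rel _ _ _ G.
- exists (s ++ s') => t ut st; rewrite (sP t) ?(sP' t) //.
  + rewrite /S scaler_sumr -big_split; apply: eq_bigr => x _ /=.
    by rewrite !linearP.
  + by move=> x xs; rewrite st // mem_cat xs orbT.
  + by move=> x xs; rewrite st // mem_cat xs.
- by have [s us sf] := dsum_supp f; exists (S s f); apply: GS.
- rewrite (sP (undup s)) ?undup_uniq // => [|x]; last by rewrite mem_undup.
  by rewrite /S big1 // => x _; rewrite !linear0.
exists h => x v; have [s sP] := hP (dsingle x v).
rewrite (sP (undup (x :: s))) ?undup_uniq // => [|y]; last first.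
  by rewrite mem_undup inE orbC => ->.
rewrite /S (bigD1_seq x) ?undup_uniq ?mem_undup ?mem_head //= coef_single eqxx.
by rewrite big1 ?addr0 // => y /negbTE yx; rewrite coef_single yx linear0.
Qed.

Lemma dsum_eq (N : lmodType R) (h h' : {linear dsum -> N}) :
  (forall x v, h (dsingle x v) = h' (dsingle x v)) -> forall f, h f = h' f.
Proof.
move=> hh f; have [s us sf] := dsum_supp f.
by rewrite (dsum_decomp us sf) !linear_sum; apply: eq_bigr => x _.
Qed.

Lemma dsum_projective : projective V -> projective dsum.
Proof.
move=> projV A B p g surjp.
have lift x : exists h : {linear V -> A}, forall v, p (h v) = g (dsingle x v).
  exact: (projV _ _ p (lin_comp g (dsingle x))).
have [h hP] := choice lift; have [k kP] := dsum_univ h; exists k.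
apply: (@dsum_eq _ (lin_comp p k)) => x v /=.
by rewrite kP hP.
Qed.

End DirectSum.

Arguments coef {R X V} x.
Arguments dsingle {R X V} x.

Section Free.
Variables (R : pzRingType).

Lemma linear_eval (M : lmodType R) (m : M) : linear
  (fun r : R^o => (r : R) *: m).
Proof. by move=> a r s; rewrite scalerDl scalerA. Qed.

Lemma regular_projective : projective R^o.
Proof.
move=> A B p g surjp; have [a pa] := surjp (g 1).
exists (linear_of (linear_eval a)) => r /=.
by rewrite linearZ pa -linearZ -[r *: _]/(r * 1) mulr1.
Qed.

Definition free (X : choiceType) : lmodType R := dsum X (R^o : lmodType R).

Lemma free_projective X : projective (free X).
Proof. exact/dsum_projective/regular_projective. Qed.

Lemma free_univ (X : choiceType) (N : lmodType R) (g : X -> N) : exists h :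
  {linear free X -> N},
  forall x (r : R), h (dsingle x (r : R^o)) = r *: g x.
Proof.
have [h hP] := dsum_univ (fun x => linear_of (linear_eval (g x))).
by exists h.
Qed.

Definition free_cover (M : lmodType R) : {linear free M -> M} :=
  sval (cid (free_univ (fun x : M => x))).

Lemma free_coverE (M : lmodType R) x (r : R) :
  free_cover M (dsingle x (r : R^o)) = r *: x.
Proof. by rewrite /free_cover; case: cid. Qed.

Lemma free_cover_surj (M : lmodType R) : surj (free_cover M).
Proof. by move=> x; exists (dsingle x (1 : R^o));
  rewrite free_coverE scale1r. Qed.

End Free.

Arguments free_cover {R} M.
Arguments free_cover_surj {R} M.

Section Powers.
Variable R : pzRingType.

Definition fpow n : lmodType R := 'I_n -> (R^o : lmodType R).

Definition unit_fun p (U : zmodType) (i : 'I_p) (c : U) : 'I_p -> U :=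
  fun k => if k == i then c else 0.

Lemma unit_fun_sum p (U V : zmodType) (F : 'I_p -> U -> V) i c :
  (forall k, F k 0 = 0) -> \sum_k F k (unit_fun i c k) = F i c.
Proof.
move=> F0; rewrite (bigD1 i) //= big1 ?addr0 /unit_fun ?eqxx // => k /negbTE ->.
exact: F0.
Qed.

Lemma sum_unit_fun p (U : zmodType) (z : 'I_p -> U) : z = \sum_i unit_fun i
  (z i).
Proof.
apply/funext => k; rewrite fct_sumE (bigD1 k) //= big1 ?addr0 /unit_fun ?eqxx //
  => i.
by rewrite eq_sym => /negbTE ->.
Qed.

Variables (M : lmodType R) (n : nat) (z : 'I_n -> M).

Fact lin_comb_linear : linear (fun v : fpow n => \sum_i (v i : R) *: z i).
Proof.
move=> a v w; rewrite scaler_sumr -big_split; apply: eq_bigr => i _ /=.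
by rewrite scalerA -scalerDl.
Qed.
Definition lin_comb : {linear fpow n -> M} := linear_of lin_comb_linear.

Lemma lin_comb_unit i : lin_comb (unit_fun i (1 : R^o)) = z i.
Proof.
rewrite /= (unit_fun_sum (F := fun k (a : R) => a *: z k)) ?scale1r // => k.
by rewrite scale0r.
Qed.

Lemma linear_fpow (h : {linear fpow n -> M}) v :
  h v = \sum_i (v i : R) *: h (unit_fun i (1 : R^o)).
Proof.
rewrite {1}[v]sum_unit_fun linear_sum; apply: eq_bigr => i _.
rewrite -linearZ; congr (h _); apply/funext => k.
rewrite -[RHS]/((v i : R) * unit_fun i (1 : R^o) k) /unit_fun.
by case: eqP; rewrite ?mulr1 ?mulr0.
Qed.

End Powers.

Section ZornExtend.
Variables (R : pzRingType) (B N : lmodType R).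
Local Open Scope classical_set_scope.

Definition graph_linear (G : set (B * N)) :=
  (forall a x y x' y', G (x, y) -> G (x', y') -> G (a *: x + x', a *: y + y'))
    /\
  (forall y, G (0, y) -> y = 0).

Definition dom (G : set (B * N)) : set B := [set x | exists y, G (x, y)].

Variables (Dom : set B -> Prop) (G0 : set (B * N)).

Definition admissible (G : set (B * N)) :=
  [/\ G0 `<=` G, graph_linear G & Dom (dom G)].

(** Zorn's lemma for partial homomorphisms whose domains are restricted to a
    class Dom. It serves Baer's criterion, where every domain is allowed, and
    the transfinite filtration of a flat module, where the domains are the
    preimages of its terms. Partial homomorphisms are graphs, so that unions of
    chains need no gluing. *)
Lemma zorn_extend :
  (forall C : set (set B), C !=set0 -> (forall D, C D -> Dom D) ->
     total_on C subset -> Dom (\bigcup_(D in C) D)) ->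
  G0 (0, 0) -> admissible G0 ->
  (forall G, admissible G -> (forall x, dom G x) \/
     exists G', [/\ admissible G', G `<=` G' & ~ (G' `<=` G)]) ->
  exists h : {linear B -> N}, forall x y, G0 (x, y) -> h x = y.
Proof.
move=> chainD G00 adG0 step.
have [F FP totF|A [PA maxA]] :=
    @Zorn_bigcup _ (fun G => G = set0 \/ admissible G).
  have [[G [FG adG]]|noG] := pselect (exists G, F G /\ admissible G);
    last first.
    left; apply/seteqP; split=> // p [G FG Gp].
    by case: (FP _ FG) => [G0'|adG]; [rewrite G0' in Gp|case: noG; exists G].
  have goodF G' p : F G' -> G' p -> admissible G'.
    by move=> FG' G'p; case: (FP _ FG') => // G0'; rewrite G0' in G'p.
  right; split.
  - by move=> p G0p; exists G => //; case: adG => /(_ _ G0p).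
  - split=> [a x y x' y' [G1 F1 g1] [G2 F2 g2]|y [G1 F1 g1]]; last first.
      by have [_ [_ +] _] := goodF _ _ F1 g1; apply.
    have [_ [l1 _] _] := goodF _ _ F1 g1; have [_ [l2 _] _] := goodF _ _ F2 g2.
    have [s|s] := totF _ _ F1 F2; first by exists G2 => //; apply: l2 => //;
      exact: s.
    by exists G1 => //; apply: l1 => //; exact: s.
  - have -> : dom (\bigcup_(X in F) X) =
        \bigcup_(D in [set dom G' | G' in [set G' | F G' /\ admissible G']]) D.
      apply/seteqP; split=> [x [y [G' FG' G'xy]]|x
        [_ [G' [FG' adG'] <-] [y G'xy]]].
        exists (dom G'); last by exists y.
        by exists G' => //; split=> //; apply: goodF G'xy.
      by exists y, G'.
    apply: chainD; first by exists (dom G), G.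
      by move=> _ [G' [_ []] _ _ ? <-].
    move=> _ _ [G1 [F1 _] <-] [G2 [F2 _] <-].
    by have [s|s] := totF _ _ F1 F2; [left|right] => x [y /s xy]; exists y.
have adA : admissible A.
  case: PA => // A0; case: (maxA G0); last by right.
  by rewrite A0; split=> // s; apply: (s (0, 0)).
have [_ [linA sgA] _] := adA.
have [totA|[G' [adG' AG' nG'A]]] := step A adA; last first.
  by case: (maxA G'); [split | right].
have [|//|//|h hP] := @linear_rel _ B N (fun x y => A (x, y)).
  exact: linA.
exists h => x y G0xy; have /(_ _ G0xy) Axy : G0 `<=` A by case: adA.
apply/eqP; rewrite -subr_eq0; apply/eqP/sgA.
have := linA (-1) _ _ _ _ Axy (hP x).
by rewrite !scaleN1r addNr addrC.
Qed.

End ZornExtend.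

(** * Baer's criterion and characters with values in Q/Z *)

(** Baer's criterion. If x lies outside the domain of a partial extension, the
    scalars s with s x in the domain form a left ideal J; extending s |-> (value
    at s x) from J to R finds a value for x. *)
Lemma baer (R : pzRingType) (E : lmodType R) :
  (forall (J : submodule (R^o : lmodType R)) (f : {linear subm J -> E}),
    exists y, forall s, f s = (incl s : R) *: y) -> injective_module E.
Proof.
move=> baerE A B i g inji.
pose G0 (p : B * E) := exists a, p = (i a, g a).
have [//|||G [G0G [linG sgG] _]|h hP] := @zorn_extend _ _ _ (fun _ => True) G0.
- by exists 0; rewrite !linear0.
- split=> //; split=> [a x y x' y' [u [-> ->]] [v [-> ->]]|y [u [/esym]]].
    by exists (a *: u + v); rewrite !linearP.
  by rewrite -[X in _ = X](linear0 i) => /inji-> ->; rewrite linear0.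
- have [totG|/existsNP[x nx]] := pselect (forall x, dom G x); [by left|right].
  have J0 : dom G ((0 : R) *: x).
    by exists 0; rewrite scale0r; have := G0G (0, 0); apply; exists 0;
      rewrite !linear0.
  have G00 : G (0, 0) by apply: G0G; exists 0; rewrite !linear0.
  have JP (a r s : R^o) : dom G ((r : R) *: x) -> dom G ((s : R) *: x) ->
      dom G ((a *: r + s : R) *: x).
    move=> [y Gy] [z Gz]; exists ((a : R) *: y + z).
    by rewrite scalerDl -scalerA; apply: linG.
  pose J := @Submodule R R^o (fun s => dom G ((s : R) *: x)) J0 JP.
  have [a r y s z Gy Gz|r|y|f fP] := @linear_rel R (subm J) E
      (fun r y => G ((incl r : R) *: x, y)).
  + by rewrite linearP scalerDl -scalerA; apply: linG.
  + exact: (inclP r).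
  + by rewrite linear0 scale0r; apply: sgG.
  have [y yP] := baerE J f.
  pose G' (p : B * E) := exists b n (s : R), G (b, n)
    /\ p = (b + s *: x, n + s *: y).
  have GG' : (G `<=` G')%classic.
    by move=> [b n] Gbn; exists b, n, 0; rewrite !scale0r !addr0.
  exists G'; split=> // [|G'G]; last first.
    case: nx; exists y; apply: G'G; exists 0, 0, 1.
    by rewrite !scale1r !add0r.
  split=> //; first by move=> p /G0G /GG'.
  split=> [a u v u' v' [b [n [s [Gbn [-> ->]]]]]
    [b' [n' [s' [Gbn' [-> ->]]]]]|v].
    exists (a *: b + b'), (a *: n + n'), (a * s + s'); split; first exact: linG.
    by rewrite !scalerDr !scalerDl !scalerA !addrA; congr pair; rewrite -!addrA;
      congr (_ + _); rewrite addrCA.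
  move=> [b [n [s [Gbn [/esym/eqP]]]]]; rewrite addrC addr_eq0 => /eqP sb ->.
  have GN : G (s *: x, - n).
    by have := linG (-1) _ _ _ _ Gbn G00; rewrite !addr0 !scaleN1r sb.
  have [|r rs] := @incl_onto _ _ J s; first by exists (- n).
  rewrite -[s]rs -[X in n + X](yP r); apply/sgG.
  have := linG (-1) _ _ _ _ GN (fP r); rewrite rs scaleN1r addNr.
  by rewrite scaleN1r opprK.
have linh := linearP h; exists h => a; apply: hP; by exists a.
Qed.

Lemma int_ideal (J : submodule (int^o : lmodType int)) :
  exists d : nat, forall m : int, J m <-> (d %| m)%Z.
Proof.
have JM (a m : int) : J m -> J (a * m) by apply: (@in_subZ _ _ J a).
have [[m [Jm m0]]|noJ] := pselect (exists m : nat, J m%:Z /\ (0 < m)%N).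
  have exm : exists m : nat, `[< J m%:Z /\ (0 < m)%N >] by exists m;
    apply/asboolP.
  case: (ex_minnP exm) => d /asboolP[Jd d0] mind; exists d => n; split;
    last first.
    by case/dvdzP=> q ->; apply: JM.
  move=> Jn; have Jr : J (n %% d)%Z.
    have -> : (n %% d)%Z = - (n %/ d)%Z * d + n.
      by rewrite {3}(divz_eq n d) mulNr addKr.
    by apply: (@in_subD _ _ J) => //; apply: JM.
  apply/dvdz_mod0P/eqP/negPn/negP => nd.
  have d0' : d%:Z != 0 by case: (d) d0.
  have rE := gez0_abs (modz_ge0 n d0').
  have : (`|(n %% d)%Z| < d)%N by rewrite -ltz_nat rE ltz_pmod.
  rewrite ltnNge => /negP; apply; apply: mind; apply/asboolP.
  by rewrite rE lt0n absz_eq0.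
exists 0%N => m; rewrite dvd0z; split=> [Jm|/eqP ->]; last exact: (in_sub0 J).
apply/negPn/negP => m0; apply: noJ; exists `|m|%N; rewrite absz_gt0; split=> //.
by case: (intP m) Jm => // k Jk; rewrite abszN -[k.+1%:Z]opprK -mulN1r;
  apply: JM.
Qed.

Section RationalsModIntegers.

Local Notation Q := (zmodule rat : lmodType int).

Fact int_in_rat0 : exists m : int, (0 : Q) = (m%:~R : rat).
Proof. by exists 0. Qed.
Fact int_in_ratP a (x y : Q) : (exists m : int, x = (m%:~R : rat)) ->
  (exists m : int, y = (m%:~R : rat)) ->
  exists m : int, a *: x + y = (m%:~R : rat).
Proof.
move=> [m ->] [n ->]; exists (a * m + n).
by rewrite -[a *: _]/((m%:~R : rat) *~ a) -mulrzl intrD intrM.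
Qed.
Definition QZ : lmodType int := quom (Submodule int_in_rat0 int_in_ratP).
Definition to_QZ : {linear Q -> QZ} := proj _.

Lemma to_QZ_eq0 (x : rat) : to_QZ x = 0 <-> exists m : int, x = m%:~R.
Proof. exact: proj_eq0. Qed.

End RationalsModIntegers.

Lemma int_linear (V W : lmodType int) (f : V -> W) : zmod_morphism f ->
  linear f.
Proof.
move=> fB.
have f0 : f 0 = 0 by rewrite -(subrr 0) fB subrr.
have fN x : f (- x) = - f x by rewrite -sub0r fB f0 sub0r.
have fD x y : f (x + y) = f x + f y by rewrite -{1}[y]opprK fB fN opprK.
have fMn x k : f (x *+ k) = f x *+ k.
  by elim: k => [|k IH]; rewrite ?mulr0n // !mulrS fD IH.
move=> a x y; rewrite fD; congr (_ + _); rewrite -{1 2}(intz a) !scaler_int.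
by case: (intP a) => [|k|k]; rewrite ?mulr0z // ?mulrNz -!pmulrn ?fN fMn.
Qed.

Lemma QZ_injective : injective_module QZ.
Proof.
apply: baer => J f; have [d dP] := int_ideal J.
have [/= u uE] : exists u : subm J, incl u = d%:Z :> int.
  by apply: incl_onto; apply/dP.
have [q qE] : exists q : zmodule rat, to_QZ q = f u by apply: proj_surj.
case: (eqVneq d 0%N) dP uE => [->|d0] dP uE.
  exists 0 => s; rewrite scaler0 -(linear0 f); congr (f _); apply: incl_inj.
  by rewrite linear0; have := inclP s; rewrite dP dvd0z => /eqP.
have d0' : d%:~R != 0 :> rat by rewrite intr_eq0.
exists (to_QZ ((d%:~R : rat)^-1 * q : rat)) => s.
have /dP/dvdzP[m sE] := inclP s.
have su : s = m *: u by apply: incl_inj; rewrite [RHS]linearZ uE sE.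
transitivity (to_QZ (m *: q)); first by rewrite su !linearZ qE.
transitivity (to_QZ ((m * d) *: (d%:~R^-1 * q : zmodule rat)));
  last by rewrite sE linearZ.
congr (to_QZ _).
rewrite -[RHS]/((d%:~R^-1 * q : rat) *~ (m * d)) -[LHS]/((q : rat) *~ m).
by rewrite -[LHS]mulrzl -[RHS]mulrzl intrM; field.
Qed.

(** The class of 1/e is such an element. *)
Lemma QZ_torsion (e : nat) : (1 < e)%N ->
  exists2 y : QZ, y != 0 & forall m : int, (e %| m)%Z -> m *: y = 0.
Proof.
move=> e1; have e0 : e%:~R != 0 :> rat by rewrite intr_eq0; case: e e1.
exists (to_QZ ((e%:~R)^-1 : rat)) => [|m /dvdzP[k ->]].
  apply/eqP => /to_QZ_eq0[m /(congr1 ( *%R e%:~R))]; rewrite mulfV // -intrM.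
  rewrite -[1]/(1%:~R) => /intr_inj em.
  have : (e %| 1)%Z by apply/dvdzP; exists m; rewrite mulrC.
  by rewrite dvdz1 => /eqP e1'; rewrite -[e]/(`|e|)%N e1' in e1.
rewrite -linearZ; apply/to_QZ_eq0; exists k.
rewrite -[LHS]/((e%:~R^-1 : rat) *~ (k * e)) -mulrzl intrM.
by field.
Qed.

Lemma char_ext (A B : zmodType) (i : A -> B) (g : A -> QZ) :
  zmod_morphism i -> injective i -> zmod_morphism g ->
  exists2 h : B -> QZ, zmod_morphism h & forall a, h (i a) = g a.
Proof.
move=> li inji lg.
have [h hP] := QZ_injective
  (i := linear_of (int_linear
    (li : zmod_morphism (i : zmodule A -> zmodule B))))
  (linear_of (int_linear (lg : zmod_morphism (g : zmodule A -> QZ)))) inji.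
by exists h => //; apply: (linearB h).
Qed.

(** Exactness of Hom(-, Q/Z): g factors through the image of t and extends from
    there. *)
Lemma char_factor (A B : zmodType) (t : A -> B) (g : A -> QZ) :
  zmod_morphism t -> zmod_morphism g -> (forall a, t a = 0 -> g a = 0) ->
  exists2 h : B -> QZ, zmod_morphism h & forall a, h (t a) = g a.
Proof.
move=> lt lg kg.
pose T := linear_of (int_linear
  (lt : zmod_morphism (t : zmodule A -> zmodule B))).
pose G := linear_of (int_linear (lg : zmod_morphism (g : zmodule A -> QZ))).
have [T' T'P] := corestrict (f := T) (D := im_sub T)
  (fun a => ex_intro _ a erefl).
have [||h hP] := @factor_surj _ _ _ _ T' G.
- by move=> w; have [a aw] := inclP w; exists a; apply: incl_inj; rewrite T'P.
- by move=> a /(congr1 incl); rewrite T'P linear0 => /kg.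
have [k kP] := QZ_injective h (@incl_inj _ _ (im_sub T)).
exists k => [|a]; first exact: (linearB k).
by rewrite -[t a]/(T a) -T'P kP hP.
Qed.

(** Q/Z is a cogenerator: modulo H the element x generates a nontrivial cyclic
    group, which is mapped onto the group generated by 1/e, where e is its
    order, or 2 if the order is infinite. *)
Lemma char_sep (A : zmodType) (H : A -> Prop) :
  H 0 -> (forall x y, H x -> H y -> H (x - y)) -> forall x, ~ H x ->
  exists chi : A -> QZ, [/\ zmod_morphism chi, forall y, H y ->
    chi y = 0 & chi x <> 0].
Proof.
move=> H0 HB x nHx.
have HN y : H y -> H (- y) by move=> Hy; rewrite -sub0r; apply: HB.
have HD y z : H y -> H z -> H (y + z).
  by move=> Hy Hz; rewrite -[z]opprK; apply: HB => //; apply: HN.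
have HL (a : int) (y z : zmodule A) : H y -> H z -> H (a *: y + z).
  move=> Hy Hz; apply: (HD) => //; have HMn k : H (y *+ k).
    by elim: k => [|k IH]; rewrite ?mulr0n // mulrS; apply: HD.
  rewrite -(intz a) scaler_int.
  by case: (intP a) => [|k|k]; rewrite ?mulr0z // ?mulrNz -!pmulrn //;
    apply: HN.
pose D := @Submodule int (zmodule A) H H0 HL.
pose z := proj D (x : zmodule A).
have z0 : z <> 0 by move/proj_eq0.
pose u : {linear int^o -> quom D} := linear_of (linear_eval z).
have [d dP] := int_ideal (ker_sub u).
pose e := if d == 0%N then 2%N else d.
have e1 : (1 < e)%N.
  rewrite /e; case: eqP => // /eqP d0; rewrite ltn_neqAle lt0n d0 andbT.
  apply/eqP => d1; have /dP : (d %| 1)%Z by rewrite -d1.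
  by rewrite /= scale1r.
have [y y0 yP] := QZ_torsion e1.
have [||h hP] := @factor_surj _ _ _ _
  (sval (cid (corestrict (f := u) (D := im_sub u)
  (fun m => ex_intro _ m erefl)))) (linear_of (linear_eval y)).
- move=> w; have [m mw] := inclP w; exists m.
  by apply: incl_inj; case: cid => /= u' ->.
- move=> m; case: cid => /= u' u'P /(congr1 incl); rewrite u'P linear0 => um0.
  apply: yP; have /dP : ker_sub u m by [].
  by rewrite /e; case: eqP => // ->; rewrite dvd0z => /eqP ->; apply: dvdz0.
move: hP; case: cid => /= u' u'P hP.
have [k kP] := QZ_injective h (@incl_inj _ _ (im_sub u)).
exists (fun a => k (proj D (a : zmodule A))); split.
- by move=> a b; rewrite -!linearB.
- by move=> a Ha; have /proj_eq0 -> : D a by []; rewrite linear0.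
have -> : proj D (x : zmodule A) = incl (u' 1) by rewrite u'P /= scale1r.
by rewrite kP hP /= scale1r; apply/eqP.
Qed.

(** Right modules over S are left modules over an opposite ring of S. Opposite
    rings are encoded by a pair of mutually inverse antimorphisms rather than by
    S and S^c, because the converse of S^c is not convertible to S; every
    statement then applies to both sides. *)
Record antimorphism (R S : pzRingType) := Antimorphism {
  antimor :> R -> S;
  antimorB : zmod_morphism antimor;
  antimor1 : antimor 1 = 1;
  antimorM : forall a b, antimor (a * b) = antimor b * antimor a }.

Lemma antimor0 (R S : pzRingType) (phi : antimorphism R S) : phi 0 = 0.
Proof. by rewrite -(subrr 0) antimorB subrr. Qed.

Lemma antimorD (R S : pzRingType) (phi : antimorphism R S) a b :
  phi (a + b) = phi a + phi b.
Proof.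
have pN c : phi (- c) = - phi c by rewrite -sub0r antimorB antimor0 sub0r.
by rewrite -{1}[b]opprK antimorB pN opprK.
Qed.

Section CharacterModule.
Variables (R S : pzRingType) (phi : antimorphism R S) (B : lmodType S).

Fact char_group0 : zmod_morphism (0 : B -> QZ).
Proof. by move=> x y; rewrite subrr. Qed.
Fact char_groupP (a : int) (f g : B -> QZ) : zmod_morphism f ->
  zmod_morphism g ->
  zmod_morphism (a *: f + g).
Proof.
move=> fB gB x y.
rewrite -[LHS]/(a *: f (x - y) + g (x - y)) fB gB scalerBr addrACA -opprD.
by [].
Qed.
Definition char_group := Submodule char_group0 char_groupP.

(** The antimorphism is an argument of the type because it determines the scalar
    multiplication. *)
Definition char_type of antimorphism R S := submod char_group.
Local Notation chr_type := (char_type phi).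
HB.instance Definition _ := GRing.Zmodule.on chr_type.

Definition ev (c : chr_type) (x : B) : QZ := incl (c : subm char_group) x.

Lemma ev_morph c : zmod_morphism (ev c). Proof. exact: (inclP c). Qed.
HB.instance Definition _ c := GRing.isZmodMorphism.Build B QZ (ev c)
  (ev_morph c).

Lemma evB c c' x : ev (c - c') x = ev c x - ev c' x.
Proof. by rewrite /ev linearB. Qed.

Lemma evD c c' x : ev (c + c') x = ev c x + ev c' x.
Proof. by rewrite /ev linearD. Qed.

Lemma ev0 x : ev 0 x = 0. Proof. by rewrite /ev linear0. Qed.

Lemma ev_inj c c' : ev c =1 ev c' -> c = c'.
Proof. by move=> e; apply: incl_inj; apply/funext. Qed.

Lemma chr_of (f : B -> QZ) : zmod_morphism f -> {c : chr_type | ev c =1 f}.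
Proof.
move=> fB; have [c cP] := cid (incl_onto (D := char_group) fB).
by exists c => x; rewrite /ev cP.
Qed.

Fact chr_scale_morph r c : zmod_morphism (fun x => ev c (phi r *: x)).
Proof. by move=> x y; rewrite scalerBr raddfB. Qed.

Definition chr_scale r c := sval (chr_of (chr_scale_morph r c)).

Lemma chr_scaleE r c x : ev (chr_scale r c) x = ev c (phi r *: x).
Proof. exact: (svalP (chr_of _)). Qed.

Fact chr_scaleA a b c : chr_scale a (chr_scale b c) = chr_scale (a * b) c.
Proof. by apply: ev_inj => x; rewrite !chr_scaleE scalerA antimorM. Qed.
Fact chr_scale1 : left_id 1 chr_scale.
Proof. by move=> c; apply: ev_inj => x; rewrite chr_scaleE antimor1 scale1r.
  Qed.
Fact chr_scaleDr : right_distributive chr_scale +%R.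
Proof. by move=> r c c'; apply: ev_inj => x; rewrite evD !chr_scaleE evD. Qed.
Fact chr_scaleDl c : {morph chr_scale^~ c : a b / a + b}.
Proof.
move=> a b; apply: ev_inj => x.
by rewrite evD !chr_scaleE antimorD scalerDl raddfD.
Qed.
HB.instance Definition _ := GRing.Zmodule_isLmodule.Build R chr_type
  chr_scaleA chr_scale1 chr_scaleDr chr_scaleDl.

(** Hom(B, Q/Z) as a module over the opposite ring. *)
Definition chr : lmodType R := chr_type.

Lemma evZ r (c : chr) x : ev (r *: c) x = ev c (phi r *: x).
Proof. exact: chr_scaleE. Qed.

End CharacterModule.

Arguments chr_of {R S} phi {B f}.

(** * The adjunction between the two character functors *)

Section CharacterMap.
Variables (R S : pzRingType) (phi : antimorphism R S).

Lemma chr_map_ex (A B : lmodType S) (f : {linear A -> B}) :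
  exists h : {linear chr phi B -> chr phi A},
    forall c x, ev (h c) x = ev c (f x).
Proof.
have [a c d c' d' e e' x|c|d dP|h hP] :=
    @linear_rel _ (chr phi B) (chr phi A) (fun c d =>
      forall x, ev d x = ev c (f x)).
- by rewrite !evD !evZ e e' linearZ.
- have fc : zmod_morphism (fun x => ev c (f x)) by move=> x y;
  rewrite linearB raddfB.
  by exists (sval (chr_of phi fc)) => x; apply: (svalP (chr_of phi fc)).
- by apply: ev_inj => x; rewrite dP !ev0.
by exists h.
Qed.

Definition chr_map (A B : lmodType S) (f : {linear A -> B}) :=
  sval (cid (chr_map_ex f)).

Lemma chr_mapE (A B : lmodType S) (f : {linear A -> B}) c x : ev (chr_map f c) x
  = ev c (f x).
Proof. by rewrite /chr_map; case: cid. Qed.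

Lemma chr_map_surj (A B : lmodType S) (f : {linear A -> B}) : injective f ->
  surj (chr_map f).
Proof.
move=> injf c; have [h hB hP] := char_ext (linearB f) injf (ev_morph c).
have [d dP] := chr_of phi hB; exists d; apply: ev_inj => x.
by rewrite chr_mapE dP.
Qed.

Lemma chr_map_inj (A B : lmodType S) (f : {linear A -> B}) : surj f ->
  injective (chr_map f).
Proof.
move=> sf c d e; apply: ev_inj => x; have [y <-] := sf x.
by rewrite -!chr_mapE e.
Qed.

Lemma chr_map_exact (A B C : lmodType S) (f : {linear A -> B})
  (g : {linear B -> C}) :
  exact_at f g -> exact_at (chr_map g) (chr_map f).
Proof.
move=> ex c; split=> [cf0|[d <-]]; last first.
  apply: ev_inj => x; rewrite !chr_mapE ev0.
  by rewrite (_ : g (f x) = 0) ?raddf0 //; apply/ex; exists x.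
have ck x : g x = 0 -> ev c x = 0.
  by move/ex=> [y <-]; rewrite -chr_mapE cf0 ev0.
have [h hB hP] := char_factor (linearB g) (ev_morph c) ck.
by have [d dP] := chr_of phi hB; exists d; apply: ev_inj => x;
  rewrite chr_mapE dP hP.
Qed.

End CharacterMap.

Arguments chr_map {R S} phi {A B} f.
Arguments chr_map_surj {R S} phi {A B f}.
Arguments chr_map_inj {R S} phi {A B f}.
Arguments chr_map_exact {R S} phi {A B C f g}.

Section CharacterSums.
Variables (R S : pzRingType) (phi : antimorphism R S) (U : lmodType S).

Lemma chr_sum p (F : 'I_p -> chr phi U) x : ev (\sum_i F i) x = \sum_i ev (F i)
  x.
Proof. by apply: (big_morph (fun f : chr phi U => ev f x)) => [f g|];
  rewrite ?evD ?ev0. Qed.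

Lemma char_split p (chi : ('I_p -> U) -> QZ) : zmod_morphism chi ->
  exists c : 'I_p -> chr phi U, forall z, chi z = \sum_i ev (c i) (z i).
Proof.
move=> chiB; have chi0 : chi 0 = 0 by rewrite -(subrr 0) chiB subrr.
have chiD y y' : chi (y + y') = chi y + chi y'.
  by rewrite -{1}[y']opprK chiB -[- y']sub0r chiB chi0 sub0r opprK.
have cB i : zmod_morphism (fun x : U => chi (unit_fun i x)).
  move=> x y; rewrite -chiB; congr chi; apply/funext => k.
  by rewrite -[RHS]/(unit_fun i x k - unit_fun i y k) /unit_fun; case: eqP;
    rewrite ?subrr.
exists (fun i => sval (chr_of phi (cB i))) => z.
rewrite {1}[z]sum_unit_fun (big_morph chi chiD chi0); apply: eq_bigr => i _.
by rewrite (svalP (chr_of phi (cB i))).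
Qed.

End CharacterSums.

Section Adjunction.
Variables (R S : pzRingType) (phi : antimorphism R S) (psi : antimorphism S R).
Hypothesis phiK : cancel phi psi.

(** Homomorphisms from A to B^+ and from B to A^+ are the same balanced
    biadditive maps from A * B to Q/Z. *)
Lemma flip_ex (A : lmodType S) (B : lmodType R) (g : {linear A -> chr psi B}) :
  exists h : {linear B -> chr phi A}, forall b a, ev (h b) a = ev (g a) b.
Proof.
have [a b c b' c' e e' x|b|c cP|h hP] :=
    @linear_rel _ B (chr phi A) (fun b c => forall a, ev c a = ev (g a) b).
- by rewrite evD evZ e e' linearZ evZ phiK raddfD.
- have gb : zmod_morphism (fun a => ev (g a) b) by move=> x y;
  rewrite linearB evB.
  by exists (sval (chr_of phi gb)) => a; apply: (svalP (chr_of phi gb)).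
- by apply: ev_inj => x; rewrite cP ev0 raddf0.
by exists h.
Qed.

Definition flip (A : lmodType S) (B : lmodType R) (g : {linear A -> chr psi B})
  := sval (cid (flip_ex g)).

Lemma flipE (A : lmodType S) (B : lmodType R) (g : {linear A -> chr psi B}) b a
  :
  ev (flip g b) a = ev (g a) b.
Proof. by rewrite /flip; case: cid. Qed.

Lemma bidual_ex (M : lmodType R) :
  exists h : {linear M -> chr phi (chr psi M)}, forall x c, ev (h x) c = ev c x.
Proof.
by exists (flip (linear_of (linearP (idfun : chr psi M -> _)))) => x c;
  rewrite flipE.
Qed.

Definition bidual (M : lmodType R) := sval (cid (bidual_ex M)).
Lemma bidualE (M : lmodType R) x c : ev (bidual M x) c = ev c x.
Proof. by rewrite /bidual; case: cid. Qed.

Lemma bidual_inj (M : lmodType R) : injective (bidual M).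
Proof.
apply: inj_linear => x bx0; apply: contrapT => x0.
have [|chi [chiB _ chix]] := @char_sep M (fun y => y = 0) erefl _ x x0.
  by move=> y z -> ->; rewrite subrr.
have [c cP] := chr_of psi chiB; apply: chix.
by rewrite -cP -bidualE bx0 ev0.
Qed.

End Adjunction.

Arguments bidual {R S phi psi} phiK M.
Arguments bidual_inj {R S phi psi} phiK M.

Section AdjunctionInjective.
Variables (R S : pzRingType) (phi : antimorphism R S) (psi : antimorphism S R).
Hypotheses (phiK : cancel phi psi) (psiK : cancel psi phi).

(** By adjunction an extension problem for P^+ is a lifting problem for P. *)
Lemma chr_projective (P : lmodType R) : projective P ->
  injective_module (chr psi P).
Proof.
move=> projP A B i g inji.
have [h hP] := projP _ _ (chr_map phi i) (flip phiK g) (chr_map_surj phi inji).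
exists (flip psiK h) => a; apply: ev_inj => b.
by rewrite flipE -chr_mapE hP flipE.
Qed.

(** M embeds in M^++, which embeds in the dual of a free module mapping onto
    M^+. *)
Lemma enough_injectives_aux (M : lmodType S) :
  exists (I : lmodType S) (j : {linear M -> I}), injective_module I
    /\ injective j.
Proof.
exists (chr psi (free R (chr phi M))).
exists (lin_comp (chr_map psi (free_cover (chr phi M))) (bidual psiK M)); split;
  first exact/chr_projective/free_projective.
move=> x y /= /(chr_map_inj psi (free_cover_surj (chr phi M)));
  exact: bidual_inj.
Qed.

End AdjunctionInjective.

Section ConverseRing.
Variable R : pzRingType.
Fact to_conv_morph : zmod_morphism (id : R -> R^c). Proof. by []. Qed.
Definition to_conv : antimorphism R R^c :=
  @Antimorphism R R^c id to_conv_morph erefl (fun _ _ => erefl).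
Definition of_conv : antimorphism R^c R :=
  @Antimorphism R^c R id to_conv_morph erefl (fun _ _ => erefl).
End ConverseRing.

Lemma enough_injectives (R : pzRingType) (M : lmodType R) :
  exists (I : lmodType R) (j : {linear M -> I}), injective_module I
    /\ injective j.
Proof. exact: (@enough_injectives_aux _ _ (of_conv R) (to_conv R)). Qed.

(** * Vanishing of Ext by dimension shifting *)

Section ShortExact.
Variable R : pzRingType.
Implicit Types A B C M N P I K : lmodType R.

Definition ses A B C (i : {linear A -> B}) (q : {linear B -> C}) :=
  [/\ injective i, surj q & exact_at i q].

Lemma ses_ker B C (q : {linear B -> C}) :
  surj q -> ses (incl : {linear subm (ker_sub q) -> B}) q.
Proof.
split=> // [|x]; first exact: incl_inj; split=> [qx|[y <-]].
  exact: (@incl_onto _ _ (ker_sub q)).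
exact: (inclP y).
Qed.

Lemma ses_im A B (i : {linear A -> B}) :
  injective i -> ses i (proj (im_sub i)).
Proof.
by split=> // [|x]; [exact: proj_surj | exact: (@proj_eq0 _ _ (im_sub i) x)].
Qed.

Lemma ses_comp0 A B C (i : {linear A -> B}) (q : {linear B -> C}) x :
  ses i q -> q (i x) = 0.
Proof. by case=> _ _ ex; apply/ex; exists x. Qed.

(** Vanishing of Ext^1(M, N). This form is suited to filtrations: homomorphisms
    to N extend from a submodule whenever the quotient is M. *)
Definition ext1_zero M N := forall A B (i : {linear A -> B})
  (q : {linear B -> M}),
  ses i q -> forall f : {linear A -> N}, exists g : {linear B -> N},
    forall a, g (i a) = f a.

(** Every extension of M is a pushout of a projective presentation, so one
    presentation decides. *)
Lemma ext1_proj K P M N (i : {linear K -> P}) (q : {linear P -> M}) :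
  projective P -> ses i q ->
  ext1_zero M N <->
  (forall f : {linear K -> N}, exists g : {linear P -> N},
    forall a, g (i a) = f a).
Proof.
move=> projP ex; split=> [|extf A B j r [injj sr exr] f]; first by move=> ext f;
  exact: ext ex f.
have [inji sq exq] := ex.
have [u uP] := projP _ _ r q sr.
have [|w wP] := factor_inj (i := j) (g := lin_comp u i) injj.
  by move=> k; apply/exr; rewrite /= uP (ses_comp0 _ ex).
have [g gP] := extf (lin_comp f w).
have [a b n b' n' [x [p [-> ->]]] [x' [p' [-> ->]]]|b|n [x [p []]]|h hP] :=
  @linear_rel _ B N (fun b n => exists a p, b = j a + u p /\ n = f a + g p).
- exists (a *: x + x'), (a *: p + p').
  by rewrite !linearP !scalerDr !addrA; split; congr (_ + _); rewrite -!addrA;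
    congr (_ + _); rewrite addrC.
- have [p pb] := sq (r b).
  have /exr[a ab] : r (b - u p) = 0 by rewrite linearB uP pb subrr.
  by exists (f a + g p), a, p; rewrite ab subrK.
- move=> e ->; have /exq[k kp] : q p = 0.
    rewrite -uP; apply/eqP; rewrite -oppr_eq0 -linearN; apply/eqP/exr.
    by exists x; apply/eqP; rewrite -addr_eq0 -e.
  have -> : x = - w k.
    by apply/injj/eqP; rewrite linearN wP -addr_eq0 /= kp -e.
  by rewrite -kp gP linearN addNr.
have lh := linearP h; exists h => a; have [x [p [e ->]]] := hP (j a).
have /exq[k kp] : q p = 0.
  rewrite -uP; have -> : u p = j (a - x) by rewrite linearB e addrC addKr.
  by apply/exr; exists (a - x).
rewrite -kp gP /= -linearD; congr (f _); apply: injj.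
by rewrite e linearD wP /= kp.
Qed.

(** Dually, every extension by N is a pullback of a given injective
    copresentation. *)
Lemma ext1_inj M N I C (j : {linear N -> I}) (c : {linear I -> C}) :
  injective_module I -> ses j c ->
  ext1_zero M N <->
  (forall f : {linear M -> C}, exists g : {linear M -> I},
    forall x, c (g x) = f x).
Proof.
move=> injI ex; have [injj sc exc] := ex; split=> [ext f|lift A B i q exi f].
  have exq := ses_ker (free_cover_surj M); set i :=
    (incl : {linear _ -> free R M}) in exq.
  have [u uP] := free_projective (lin_comp f (free_cover M)) sc.
  have [|w wP] := factor_inj (i := j) (g := lin_comp u i) injj.
    by move=> k; apply/exc; rewrite /= uP /= (ses_comp0 _ exq) linear0.
  have [g gP] := ext _ _ _ _ exq w.
  have [//|x|h hP] := @factor_surj _ _ _ _ (free_cover M)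
    (linear_of (linearP (u \- lin_comp j g))).
  - by case: exq.
  - by case: exq => _ _ exq /exq[k <-] /=; rewrite gP wP subrr.
  exists h => x; have [y <-] := free_cover_surj M x;
    rewrite hP /= linearB uP /=.
  by rewrite (ses_comp0 _ ex) subr0.
have [inji sq exq] := exi.
have [u uP] := injI _ _ i (lin_comp j f) inji.
have [//|x /exq[a <-]|v vP] := @factor_surj _ _ _ _ q (lin_comp c u).
  by rewrite /= uP (ses_comp0 _ ex).
have [g gP] := lift v.
have [x|h hP] := factor_inj (g := linear_of (linearP (u \- lin_comp g q))) injj.
  by apply/exc; rewrite /= linearB gP vP subrr.
exists h => a; apply: injj; rewrite hP /= uP (ses_comp0 _ exi).
by rewrite linear0 subr0.
Qed.

Lemma ext1_injective E : injective_module E <-> forall M, ext1_zero M E.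
Proof.
split=> [injE M A B i q [inji _ _] f|ext A B i g inji]; first exact: injE.
exact: (ext _ _ _ _ _ (ses_im inji)).
Qed.

Lemma ext1_projective P : projective P <-> forall N, ext1_zero P N.
Proof.
split=> [projP N|ext A B p g surjp].
  have exP : ses (linear_of
    (linearP (\0 : subm (ker_sub (idfun : {linear P -> P})) -> P)))
    (idfun : {linear P -> P}).
    split=> [x y _|x|x]; first by apply: incl_inj;
      rewrite [LHS](inclP x) [RHS](inclP y).
      by exists x.
    by split=> [/= ->|[y <-]//]; exists 0.
  apply/(ext1_proj _ projP exP) => f; exists (linear_of (linearP (\0 : P -> N)))
    => x /=.
  rewrite -(linear0 f); congr (f _); apply: incl_inj.
  by rewrite linear0 [RHS](inclP x).
have [s sP] : exists s : {linear P -> free R P},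
  forall x, free_cover P (s x) = x.
  have exq := ses_ker (free_cover_surj P).
  have [r rP] := ext _ _ _ _ _ exq (idfun : {linear _ -> _}).
  have [|x|s sP] := @factor_surj _ _ _ _ (free_cover P)
     (linear_of (linearP (idfun \- lin_comp incl r))).
  - exact: free_cover_surj.
  - by case: exq => _ _ exq /exq[k <-] /=; rewrite rP subrr.
  exists s => x; have [y <-] := free_cover_surj P x.
  by rewrite sP /= linearB (ses_comp0 _ exq) subr0.
have [h hP] := free_projective (lin_comp g (free_cover P)) surjp.
by exists (lin_comp h s) => x /=; rewrite hP /= sP.
Qed.

(** Both sides say that Ext^2(M, N) vanishes. *)
Lemma ext1_shift K P M N I C (i : {linear K -> P}) (q : {linear P -> M})
    (j : {linear N -> I}) (c : {linear I -> C}) :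
  projective P -> injective_module I -> ses i q -> ses j c ->
  ext1_zero K N <-> ext1_zero M C.
Proof.
move=> projP injI exq exc; split=> ext.
  apply/(ext1_proj _ projP exq) => f.
  have [g gP] := (ext1_inj K injI exc).1 ext f.
  have [h hP] := injI _ _ i g (let: And3 h _ _ := exq in h).
  by exists (lin_comp c h) => a /=; rewrite hP.
apply/(ext1_inj _ injI exc) => f.
have [g gP] := (ext1_proj C projP exq).1 ext f.
have [h hP] := projP _ _ c g (let: And3 _ h _ := exc in h).
by exists (lin_comp h i) => a /=; rewrite hP.
Qed.

Lemma ext1_retract_l M M' N (s : {linear M -> M'}) (r : {linear M' -> M}) :
  cancel s r -> ext1_zero M' N -> ext1_zero M N.
Proof.
move=> sK ext; have [I [j [injI injj]]] := enough_injectives N.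
apply/(ext1_inj _ injI (ses_im injj)) => f.
have [g gP] := (ext1_inj _ injI (ses_im injj)).1 ext (lin_comp f r).
by exists (lin_comp g s) => x /=; rewrite gP /= sK.
Qed.

Lemma ext1_retract_r M N N' (s : {linear N -> N'}) (r : {linear N' -> N}) :
  cancel s r -> ext1_zero M N' -> ext1_zero M N.
Proof.
move=> sK ext A B i q ex f; have [g gP] := ext _ _ _ _ ex (lin_comp s f).
by exists (lin_comp r g) => x /=; rewrite gP /= sK.
Qed.

Definition syz M : lmodType R := subm (ker_sub (free_cover M)).

Definition inj_env M : lmodType R := sval (cid (enough_injectives M)).
Definition to_inj_env M : {linear M -> inj_env M} :=
  sval (cid (svalP (cid (enough_injectives M)))).
Lemma inj_env_injective M : injective_module (inj_env M).
Proof. by case: (svalP (cid (svalP (cid (enough_injectives M))))). Qed.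
Lemma to_inj_env_inj M : injective (to_inj_env M).
Proof. by case: (svalP (cid (svalP (cid (enough_injectives M))))). Qed.

Definition cosyz M : lmodType R := quom (im_sub (to_inj_env M)).

Lemma ses_syz M : ses (incl : {linear syz M -> free R M}) (free_cover M).
Proof. exact/ses_ker/free_cover_surj. Qed.

Lemma ses_cosyz M : ses (to_inj_env M) (proj (im_sub (to_inj_env M))).
Proof. exact/ses_im/to_inj_env_inj. Qed.

(** The index is shifted, so that N has injective dimension at most k if and
    only if [ext_zero k M N] for all M. *)
Definition ext_zero k M N := ext1_zero M (iter k cosyz N).

Lemma ext_zero_proj k K P M N (i : {linear K -> P}) (q : {linear P -> M}) :
  projective P -> ses i q -> ext_zero k K N <-> ext_zero k.+1 M N.
Proof.
by move=> projP ex; apply: ext1_shift ex (ses_cosyz _);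
  [|exact: inj_env_injective].
Qed.

Lemma ext_zero_syz k M N : ext_zero k M N <-> ext1_zero (iter k syz M) N.
Proof.
elim: k M => [//|k IH] M; rewrite iterSr -IH; symmetry.
by apply: ext_zero_proj (ses_syz M); exact: free_projective.
Qed.

Lemma ext_zero_inj k M N I C (j : {linear N -> I}) (c : {linear I -> C}) :
  injective_module I -> ses j c -> ext_zero k M C <-> ext_zero k.+1 M N.
Proof.
move=> injI ex; rewrite !ext_zero_syz; symmetry.
by apply: (ext1_shift (@free_projective _ _) injI (ses_syz _) ex).
Qed.

(** From the exact sequence Ext^(k+1)(B, N) -> Ext^(k+1)(A, N) -> Ext^(k+2)(C,
    N). *)
Lemma ext_zero_sub k A B C N (i : {linear A -> B}) (q : {linear B -> C}) :
  ses i q -> ext_zero k B N -> ext_zero k.+1 C N -> ext_zero k A N.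
Proof.
move=> ex extB extC.
have exN := ses_cosyz (iter k cosyz N); have injI :=
  @inj_env_injective (iter k cosyz N).
apply/(ext1_inj _ injI exN) => f.
have [g gP] := extC _ _ _ _ ex f.
have [h hP] := (ext1_inj _ injI exN).1 extB g.
by exists (lin_comp h i) => a /=; rewrite hP.
Qed.

Definition pd_le M k := forall N, ext_zero k M N.
Definition id_le N k := forall M, ext_zero k M N.

Lemma pd_le0 P : pd_le P 0 <-> projective P.
Proof. by rewrite ext1_projective. Qed.

Lemma id_le0 E : id_le E 0 <-> injective_module E.
Proof. by rewrite ext1_injective. Qed.

Lemma pd_le_shift k K P M (i : {linear K -> P}) (q : {linear P -> M}) :
  projective P -> ses i q -> pd_le K k <-> pd_le M k.+1.
Proof. by move=> projP ex; split=> pd N; apply/(ext_zero_proj _ _ projP ex).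
  Qed.

Lemma id_le_shift k N I C (j : {linear N -> I}) (c : {linear I -> C}) :
  injective_module I -> ses j c -> id_le C k <-> id_le N k.+1.
Proof. by move=> injI ex; split=> pd M; apply/(ext_zero_inj _ _ injI ex). Qed.

Lemma pd_le_iter k M : pd_le M k <-> projective (iter k syz M).
Proof. by rewrite ext1_projective; split=> pd N; apply/ext_zero_syz. Qed.

Lemma id_le_iter k M : id_le M k <-> injective_module (iter k cosyz M).
Proof. by rewrite ext1_injective. Qed.

Lemma pd_leS k M : pd_le M k -> pd_le M k.+1.
Proof. by move=> pd N; rewrite /ext_zero iterSr; apply: pd. Qed.

Lemma id_leS k M : id_le M k -> id_le M k.+1.
Proof.
by move=> idM N; apply/(ext_zero_proj _ _ (@free_projective _ _) (ses_syz N)).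
Qed.

Lemma pd_le_leq k l M : (k <= l)%N -> pd_le M k -> pd_le M l.
Proof. by move=> /subnK <- pd; elim: (l - k)%N => // m; apply: pd_leS. Qed.

Lemma id_le_leq k l M : (k <= l)%N -> id_le M k -> id_le M l.
Proof. by move=> /subnK <- pd; elim: (l - k)%N => // m; apply: id_leS. Qed.

End ShortExact.

(** * Resolutions and the dimensions silp and spli *)

Section Resolutions.
Variable R : pzRingType.
Implicit Types (A B M N P I K F : lmodType R) (C : lmodType R -> Prop).

Lemma resolution0_inv C M : resolution C M 0 ->
  exists F (e : {linear F -> M}), [/\ C F, injective e & surj e].
Proof.
move=> [F [d [e [[se ex0 _] [CF F0]]]]]; exists (F 0%N), e; split=> //.
  exact: CF.
by apply: inj_linear => x /ex0[y <-]; rewrite (F0 1%N _ y) // linear0.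
Qed.

Lemma resolutionS_inv C M k : resolution C M k.+1 ->
  exists K F (i : {linear K -> F}) (q : {linear F -> M}),
    [/\ C F, ses i q & resolution C K k].
Proof.
move=> [F [d [e [[se ex0 exS] [CF F0]]]]].
exists (subm (ker_sub e)), (F 0%N), incl, e; split.
- exact: CF.
- exact: ses_ker.
have [x|e' e'P] := corestrict (f := d 0%N) (D := ker_sub e).
  by apply/ex0; exists x.
exists (fun i => F i.+1), (fun i => d i.+1), e'; split; last first.
  by split=> i; [apply: (CF i.+1) | apply: (F0 i.+1)].
split=> [y|y|i]; last exact: exS.
- have /ex0[x xy] := inclP y; exists x.
  by apply: incl_inj; rewrite e'P.
- rewrite -exS -e'P; split=> [->|y0]; first by rewrite linear0.
  by apply: incl_inj; rewrite y0 linear0.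
Qed.

Lemma coresolution0_inv C M : coresolution C M 0 ->
  exists F (e : {linear M -> F}), [/\ C F, injective e & surj e].
Proof.
move=> [F [d [e [[se ex0 _] [CF F0]]]]]; exists (F 0%N), e; split=> //.
  exact: CF.
by move=> x; apply/ex0; apply: F0.
Qed.

Lemma coresolutionS_inv C M k : coresolution C M k.+1 ->
  exists F N (j : {linear M -> F}) (c : {linear F -> N}),
    [/\ C F, ses j c & coresolution C N k].
Proof.
move=> [F [d [e [[inje ex0 exS] [CF F0]]]]].
exists (F 0%N), (quom (im_sub e)), e, (proj _); split.
- exact: CF.
- exact: ses_im.
have [//||e' e'P] := @factor_surj _ _ _ _ (proj (im_sub e)) (d 0%N).
- exact: proj_surj.
- by move=> x /proj_eq0 ?; apply/ex0.
exists (fun i => F i.+1), (fun i => d i.+1), e'; split; last first.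
  by split=> i; [apply: (CF i.+1) | apply: (F0 i.+1)].
split=> [|y|i]; last exact: exS.
- apply: inj_linear => y; have [x <-] := proj_surj _ y.
  by rewrite e'P => /ex0 ?; apply/proj_eq0.
- rewrite exS; split=> [[x <-]|[x <-]]; first by exists (proj _ x); rewrite e'P.
  by have [z <-] := proj_surj _ x; rewrite e'P; exists z.
Qed.

Definition zero_module M : lmodType R := subm
  (ker_sub (idfun : {linear M -> M})).

Lemma zero_moduleE M (x : zero_module M) : x = 0.
Proof. by apply: incl_inj; rewrite linear0; exact: (inclP x). Qed.

Definition zero_map A B : {linear A -> B} := linear_of (linearP (\0 : A -> B)).

Lemma resolution0 C M : C M -> resolution C M 0.
Proof.
move=> CM; pose F (i : nat) := if i is 0%N then M else zero_module M.
have F0 i : (0 < i)%N -> forall x : F i, x = 0 by case: i => // i _ x;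
  exact: zero_moduleE.
exists F, (fun i => zero_map (F i.+1) (F i)), (idfun : {linear M -> M}).
split; last by split=> [[]|].
split=> [x|x|i x]; first by exists x.
  by split=> [/= ->|[y <-]//]; exists 0.
by rewrite (F0 i.+1 _ x) //; split=> // _; exists 0.
Qed.

Lemma coresolution0 C M : C M -> coresolution C M 0.
Proof.
move=> CM; pose F (i : nat) := if i is 0%N then M else zero_module M.
have F0 i : (0 < i)%N -> forall x : F i, x = 0 by case: i => // i _ x;
  exact: zero_moduleE.
exists F, (fun i => zero_map (F i) (F i.+1)), (idfun : {linear M -> M}).
split; last by split=> [[]|].
split=> [x y //|x|i x]; first by split=> // _; exists x.
by rewrite (F0 i.+1 _ x) //; split=> // _; exists 0.
Qed.

Lemma resolutionS C K F M k (i : {linear K -> F}) (q : {linear F -> M}) :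
  C F -> ses i q -> resolution C K k -> resolution C M k.+1.
Proof.
move=> CF0 [inji sq exq] [F' [d [e [[se ex0 exS] [CF F0]]]]].
pose G n := if n is m.+1 then F' m else F.
pose dG n : {linear G n.+1 -> G n} :=
  match n return {linear G n.+1 -> G n} with
  | 0%N => lin_comp i e | m.+1 => d m end.
exists G, dG, q; split; last first.
  by split=> -[|m] //; [apply: CF | apply: F0].
split=> [//|y|[|m] y]; last exact: exS.
- rewrite exq; split=> [[x <-]|[x <-]]; last by exists (e x).
  by have [z <-] := se x; exists z.
- rewrite -ex0 /=; split=> [|->]; last exact: linear0.
  by rewrite -[X in _ = X](linear0 i) => /inji.
Qed.

Lemma coresolutionS C M F N k (j : {linear M -> F}) (c : {linear F -> N}) :
  C F -> ses j c -> coresolution C N k -> coresolution C M k.+1.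
Proof.
move=> CF0 [injj sc exc] [F' [d [e [[inje ex0 exS] [CF F0]]]]].
pose G n := if n is m.+1 then F' m else F.
pose dG n : {linear G n -> G n.+1} :=
  match n return {linear G n -> G n.+1} with
  | 0%N => lin_comp e c | m.+1 => d m end.
exists G, dG, j; split; last first.
  by split=> -[|m] //; [apply: CF | apply: F0].
split=> [//|y|[|m] y]; last exact: exS.
- rewrite -exc /=; split=> [|->]; last exact: linear0.
  by rewrite -[X in _ = X](linear0 e) => /inje.
- rewrite ex0; split=> [[x <-]|[x <-]]; last by exists (c x).
  by have [z <-] := sc x; exists z.
Qed.

Lemma projective_iso P M (e : {linear P -> M}) :
  injective e -> surj e -> projective P -> projective M.
Proof.
move=> inje se; rewrite !ext1_projective => ext N.
have [x|s sP] := factor_inj (i := e) (g := (idfun : {linear M -> M})) inje.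
  exact: se.
exact: ext1_retract_l sP (ext N).
Qed.

Lemma injective_iso I M (e : {linear M -> I}) :
  injective e -> surj e -> injective_module I -> injective_module M.
Proof.
move=> inje se; rewrite !ext1_injective => ext N.
have [x|s sP] := factor_inj (i := e) (g := (idfun : {linear I -> I})) inje.
  exact: se.
apply: (@ext1_retract_r _ _ _ _ e s) (ext N).
by move=> x; apply: inje; apply: sP.
Qed.

Lemma projective_resolution M k : resolution (@projective R) M k <-> pd_le M k.
Proof.
elim: k M => [|k IH] M; split=> [|pd].
- move=> /resolution0_inv[F [e [projF inje se]]].
  exact/pd_le0/(projective_iso inje se).
- exact/resolution0/pd_le0.
- move=> /resolutionS_inv[K [F [i [q [projF ex /IH pdK]]]]].
  exact/(pd_le_shift _ projF ex).
- apply: resolutionS (ses_syz M) _; first exact: free_projective.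
  by apply/IH; apply/(pd_le_shift _ _ (ses_syz M)) => //;
    exact: free_projective.
Qed.

Lemma injective_coresolution M k :
  coresolution (@injective_module R) M k <-> id_le M k.
Proof.
elim: k M => [|k IH] M; split=> [|pd].
- move=> /coresolution0_inv[F [e [injF inje se]]].
  exact/id_le0/(injective_iso inje se).
- exact/coresolution0/id_le0.
- move=> /coresolutionS_inv[F [N [j [c [injF ex /IH idN]]]]].
  exact/(id_le_shift _ injF ex).
- apply: coresolutionS (ses_cosyz M) _; first exact: inj_env_injective.
  by apply/IH; apply/(id_le_shift _ _ (ses_cosyz M)) => //;
    exact: inj_env_injective.
Qed.

End Resolutions.

Section DimensionValues.

Lemma dim_le_least (Q : nat -> Prop) n : (forall k, Q k -> Q k.+1) ->
  dim_le (least Q) n <-> Q n.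
Proof.
move=> QS; have Qle k l : (k <= l)%N -> Q k -> Q l.
  by move=> /subnK <- Qk; elim: (l - k)%N => // m; apply: QS.
case e : (least Q) => [k|] /=.
  have [Qk mink] := (leastP _ _).1 e.
  by split=> [kn|/mink//]; apply: Qle kn Qk.
split=> // Qn; have exQ : exists n, `[< Q n >] by exists n; apply/asboolP.
suff : least Q = Some (ex_minn exQ) by rewrite e.
apply/leastP; case: ex_minnP => m /asboolP Qm minm; split=> // l Ql.
exact/minm/asboolP.
Qed.

Lemma least_ext (P Q : nat -> Prop) : (forall n, P n <-> Q n) ->
  least P = least Q.
Proof. by move=> PQ; congr least; apply/funext => n; apply/propext. Qed.

Variable R : pzRingType.

Lemma proj_dimP (M : lmodType R) n : dim_le (proj_dim M) n <-> pd_le M n.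
Proof.
rewrite -projective_resolution; apply: dim_le_least => k.
by rewrite !projective_resolution; apply: pd_leS.
Qed.

Lemma inj_dimP (M : lmodType R) n : dim_le (inj_dim M) n <-> id_le M n.
Proof.
rewrite -injective_coresolution; apply: dim_le_least => k.
by rewrite !injective_coresolution; apply: id_leS.
Qed.

Definition silp_le n := forall P : lmodType R, projective P -> id_le P n.
Definition spli_le n := forall E : lmodType R, injective_module E -> pd_le E n.

Lemma silpE : silp R = least silp_le.
Proof.
apply: least_ext => n; split=> [le P projP|le _ [P [projP ->]]].
  by apply/inj_dimP/le; exists P.
exact/inj_dimP/le.
Qed.

Lemma spliE : spli R = least spli_le.
Proof.
apply: least_ext => n; split=> [le E injE|le _ [E [injE ->]]].
  by apply/proj_dimP/le; exists E.
exact/proj_dimP/le.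
Qed.

End DimensionValues.

Section FiniteDimension.
Variable R : pzRingType.

Lemma projective_retract (M P : lmodType R) (s : {linear M -> P})
  (r : {linear P -> M}) :
  cancel s r -> projective P -> projective M.
Proof. by move=> sK; rewrite !ext1_projective => ext N;
  apply: ext1_retract_l sK _. Qed.

Lemma injective_retract (M P : lmodType R) (s : {linear M -> P})
  (r : {linear P -> M}) :
  cancel s r -> injective_module P -> injective_module M.
Proof. by move=> sK; rewrite !ext1_injective => ext N;
  apply: ext1_retract_r sK _. Qed.

(** Let Z be the syzygy of order k and Z' the next one, which is projective. If
    k >= n, the injective dimension of Z' gives Ext^1(Z, Z') = Ext^(k+1)(M, Z')
    = 0. So Z is a direct summand of a free module. *)
Lemma silp_pd_le n k (M : lmodType R) : silp_le R n -> pd_le M k -> pd_le M n.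
Proof.
move=> silpn; elim: k => [|k IH] pdM; first exact: pd_le_leq pdM.
have [kn|nk] := ltnP k n; first exact: pd_le_leq pdM.
apply: IH; apply/pd_le_iter; move/pd_le_iter: pdM => /= projS.
have exS := ses_syz (iter k (@syz R) M).
have ext : ext1_zero (iter k (@syz R) M) (syz (iter k (@syz R) M)).
  by apply/ext_zero_syz; apply: (id_le_leq nk (silpn _ projS)).
have [r rP] := ext _ _ _ _ exS (idfun : {linear _ -> _}).
have [|x|s sP] := @factor_surj _ _ _ _ (free_cover (iter k (@syz R) M))
   (linear_of (linearP (idfun \- lin_comp incl r))).
- exact: free_cover_surj.
- by case: exS => _ _ exq /exq[z <-] /=; rewrite rP subrr.
apply: (@projective_retract _ _ s (free_cover _)); last exact: free_projective.
move=> x; have [y <-] := free_cover_surj _ x.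
by rewrite sP /= linearB (ses_comp0 _ exS) subr0.
Qed.

(** Dually, with cosyzygies: the injective cosyzygy of order k + 1 has
    projective dimension at most n. *)
Lemma spli_id_le n k (M : lmodType R) : spli_le R n -> id_le M k -> id_le M n.
Proof.
move=> splin; elim: k => [|k IH] idM; first exact: id_le_leq idM.
have [kn|nk] := ltnP k n; first exact: id_le_leq idM.
apply: IH; apply/id_le_iter; move/id_le_iter: idM => /= injS.
have exS := ses_cosyz (iter k (@cosyz R) M).
have ext : ext1_zero (cosyz (iter k (@cosyz R) M)) (iter k (@cosyz R) M).
  exact: (pd_le_leq nk (splin _ injS)).
have [r rP] := ext _ _ _ _ exS (idfun : {linear _ -> _}).
exact: injective_retract rP (@inj_env_injective _ _).
Qed.

End FiniteDimension.

(** * Flat modules *)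

Section TensorUniversal.
Variables (R : pzRingType) (M : lmodType R) (A : lmodType R^c).

Lemma tensor_surj : surj (@tensor_pi R M A).
Proof. by move=> t; exists (repr (t : {ideal_quot @balancedb R M A}));
  apply: reprK. Qed.

Lemma tensor_piD x y :
  @tensor_pi R M A (x + y) = tensor_pi x + tensor_pi y.
Proof. exact: (raddfD (@tensor_pi R M A)). Qed.

Lemma tensB (a : A) (m m' : M) : tens a (m - m') = tens a m - tens a m'.
Proof.
have tensD (n n' : M) : tens a (n + n') = tens a n + tens a n'.
  transitivity (@tensor_pi R M A (<< (a, n) >> + << (a, n') >>)).
    exact/tensor_piP/balanced_addr.
  exact: tensor_piD.
by have := tensD (m - m') m'; rewrite subrK => ->; rewrite addrK.
Qed.

Lemma tens_addl (a a' : A) (m : M) : tens (a + a') m = tens a m + tens a' m.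
Proof.
transitivity (@tensor_pi R M A (<< (a, m) >> + << (a', m) >>)).
  exact/tensor_piP/balanced_addl.
exact: tensor_piD.
Qed.

Lemma tens_scale (a : A) (r : R) (m : M) : tens ((r : R^c) *: a) m = tens a
  (r *: m).
Proof. exact/tensor_piP/balanced_scale. Qed.

Lemma tensor_univ (g : {linear A -> chr (of_conv R) M}) :
  exists2 t : tensor M A -> QZ, zmod_morphism t
    & forall a m, t (tens a m) = ev (g a) m.
Proof.
pose L : {freeg (A * M)%type} -> QZ := fglift (fun am => ev (g am.1) am.2).
have LB : {morph L : x y / x - y} by apply: lift_is_additive.
have LU a m : L << (a, m) >> = ev (g a) m by rewrite /L liftU scale1r.
have L0 : L 0 = 0 by rewrite -(subrr 0) LB subrr.
have LD x y : L (x + y) = L x + L y.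
  by rewrite -{1}[y]opprK LB -[- y]sub0r LB L0 sub0r opprK.
have Lbal x : balanced x -> L x = 0.
  elim=> [a a' m|a m m'|a r m||y z _ y0 _ z0] //.
  - by rewrite LB LD !LU linearD evD subrr.
  - by rewrite LB LD !LU raddfD subrr.
  - by rewrite LB !LU linearZ evZ subrr.
  - by rewrite LB y0 z0 subrr.
have [s sP] := choice tensor_surj.
have sL x : L (s (tensor_pi x)) = L x.
  apply/eqP; rewrite -subr_eq0 -LB; apply/eqP/Lbal/tensor_piP; exact: sP.
exists (fun t => L (s t)) => [t u|a m]; last by rewrite sL LU.
by rewrite -[t in LHS]sP -[u in LHS]sP -raddfB sL LB.
Qed.

End TensorUniversal.

(** A homomorphism from A to M^+ is a character of the tensor product of A with
    M; it extends along the injective map of tensor products because Q/Z is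
    injective. *)
Lemma flat_chr_injective (R : pzRingType) (M : lmodType R) :
  flat M -> injective_module (chr (of_conv R) M).
Proof.
move=> flatM A B i g inji.
have [t tB tP] := tensor_univ g.
have [u uB uP] := char_ext (@tensor_map_is_additive _ _ _ _ i)
  (flatM _ _ _ inji) tB.
have uN : u 0 = 0 by rewrite -(subrr 0) uB subrr.
have uD x y : u (x + y) = u x + u y.
  by rewrite -{1}[y]opprK uB -[- y]sub0r uB uN sub0r opprK.
have [a b c b' c' e e' m|b|c cP|h hP] := @linear_rel _ B (chr (of_conv R) M)
    (fun b c => forall m, ev c m = u (tens b m)).
- by rewrite evD evZ e e' tens_addl uD -tens_scale.
- have bB : zmod_morphism (fun m => u (tens b m)) by move=> m m';
  rewrite tensB uB.
  by exists (sval (chr_of (of_conv R) bB)) => m; apply: (svalP (chr_of _ bB)).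
- apply: ev_inj => m; rewrite cP ev0.
  have /(congr1 (fun x => x - tens 0 m)) := tens_addl (0 : B) 0 m.
  by rewrite addr0 addrK subrr => <-.
exists h => a; apply: ev_inj => m.
by rewrite hP -tensor_map_tens uP tP.
Qed.

Section FlatPurity.
Variables (R S : pzRingType) (phi : antimorphism R S) (psi : antimorphism S R).
Hypotheses (phiK : cancel phi psi).
Variables (X : choiceType) (B K : lmodType R).
Variables (j : {linear K -> free R X}) (q : {linear free R X -> B}).
Hypotheses (ex : ses j q) (injB : injective_module (chr psi B)).

(** The equational criterion for flatness, by duality. The right hand sides that
    the conclusion allows form a subgroup of B^n. A character c of B^n that
    kills this subgroup defines a homomorphism from S^n to B^+ that kills the
    kernel of the matrix r; it extends from the image of r to S^p, so c is a
    combination of the rows of r and kills b. *)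
Lemma flat_equations n p (r : 'I_p -> 'I_n -> R) (b : 'I_n -> B) :
  (forall k, \sum_i r k i *: b i = 0) ->
  exists l : seq (('I_n -> R) * B),
    (forall z, z \in l -> forall k, \sum_i r k i * z.1 i = 0) /\
    (forall i, b i = \sum_(z <- l) z.1 i *: z.2).
Proof.
move=> rb; pose NB (y : 'I_n -> B) := exists l : seq (('I_n -> R) * B),
    (forall z, z \in l -> forall k, \sum_i r k i * z.1 i = 0) /\
    (forall i, y i = \sum_(z <- l) z.1 i *: z.2).
apply: contrapT => nNB.
have NB0 : NB 0 by exists [::]; split=> // i; rewrite big_nil.
have NBB y y' : NB y -> NB y' -> NB (y - y').
  move=> [l [lr ly]] [l' [lr' ly']].
  exists (l ++ [seq (z.1, - z.2) | z <- l']); split=> [z|i].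
    by rewrite mem_cat => /orP[/lr//|/mapP[z' /lr' zr ->]].
  rewrite -[LHS]/(y i - y' i) ly ly' big_cat big_map -sumrN; congr (_ + _).
  by apply: eq_bigr => z _ /=; rewrite scalerN.
have [chi [chiB chiN chib]] := char_sep NB0 NBB nNB; apply: chib.
have [c cP] := char_split psi chiB.
(* A multiplies row vectors over S by the transpose of r. *)
pose A : {linear fpow S n -> fpow S p} := lin_comb
  (fun i k => phi (r k i) : S^o).
have AE v k : A v k = \sum_i (v i : S) * phi (r k i) by rewrite /= fct_sumE.
have [A' A'P] := corestrict (f := A) (D := im_sub A)
  (fun v => ex_intro _ v erefl).
have sA' : surj A'.
  by move=> w; have [v vw] := inclP w; exists v; apply: incl_inj; rewrite A'P.
have [|g gP] := factor_surj (g := lin_comb c) sA'.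
  move=> v /(congr1 incl); rewrite A'P linear0 => Av0.
  apply: ev_inj => m; rewrite ev0 chr_sum.
  under eq_bigr => i _ do rewrite evZ.
  rewrite -(cP (fun i => psi (v i) *: m)); apply: chiN.
  exists [:: (fun i => psi (v i), m)]; split=> [z|i]; last by rewrite big_seq1.
  rewrite inE => /eqP -> k; transitivity (psi (A v k)); last first.
    by rewrite Av0; apply: antimor0.
  rewrite AE (big_morph psi (antimorD psi) (antimor0 psi)).
  by apply: eq_bigr => i _; rewrite antimorM phiK.
have [G GP] := injB g (@incl_inj _ _ (im_sub A)).
pose d k := G (unit_fun k (1 : S^o)).
have cE i : c i = \sum_k phi (r k i) *: d k.
  rewrite -lin_comb_unit -gP -GP A'P linear_fpow; apply: eq_bigr => k _.
  rewrite AE; congr (_ *: _).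
  rewrite (unit_fun_sum (F := fun i' (a : S) => a * phi (r k i'))) ?mul1r // =>
    i'.
  exact: mul0r.
rewrite cP; under eq_bigr => i _ do rewrite cE chr_sum.
rewrite exchange_big big1 // => k _ /=.
transitivity (ev (d k) (\sum_i r k i *: b i)); last by rewrite rb raddf0.
by rewrite raddf_sum; apply: eq_bigr => i _; rewrite evZ phiK.
Qed.

(** Villamayor's criterion. Each basis element that occurs in xs is corrected by
    a lift of what the equational criterion provides for its image in B, so that
    it moves into K; the corrections cancel on xs because the coefficients of xs
    annihilate them. *)
Lemma flat_pure (xs : seq K) : exists (f : {linear free R X -> K}) (ys : seq K),
  (forall u, span (fun y => y \in ys) (f u))
    /\ (forall x, x \in xs -> f (j x) = x).
Proof.
have [inj_j sq exq] := ex.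
have [s us sP] : exists2 s : seq X, uniq s &
    forall x, x \in xs -> forall t, t \notin s -> coef t (j x) = 0.
  elim: xs => [|x xs [s us sP]]; first by exists [::].
  have [t ut tP] := dsum_supp (j x).
  exists (undup (s ++ t)) => [|y]; first exact: undup_uniq.
  rewrite inE => /orP[/eqP ->|/sP yP] z; rewrite mem_undup mem_cat negb_or.
    by move=> /andP[_ /tP].
  by move=> /andP[/yP].
pose n := size s; pose sx i := tnth (in_tuple s) (i : 'I_n).
pose r (k : 'I_(size xs)) i : R := coef (sx i) (j (tnth (in_tuple xs) k)).
have jE (k : 'I_(size xs)) :
    j (tnth (in_tuple xs) k) = \sum_i r k i *: dsingle (sx i) (1 : R^o).
  rewrite {1}(dsum_decomp us (sP _ (mem_tnth k (in_tuple xs))))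
    (big_tnth _ _ s).
  apply: eq_bigr => i _; rewrite -linearZ; congr (dsingle _ _).
  by rewrite -[RHS]/(r k i * 1) mulr1.
have [k|l [lr lb]] := @flat_equations n (size xs) r
  (fun i => q (dsingle (sx i) (1 : R^o))).
  rewrite -[RHS](ses_comp0 (tnth (in_tuple xs) k) ex) jE linear_sum.
  by apply: eq_bigr => i _; rewrite linearZ.
have [t tP] := choice sq.
pose w i := dsingle (sx i) (1 : R^o) - \sum_(z <- l) z.1 i *: t z.2.
have yex i : exists y, j y = w i.
  apply/exq; rewrite linearB lb linear_sum /= -sumrB big1 // => z _.
  by rewrite linearZ tP subrr.
have [y yP] := choice yex.
pose f (u : free R X) := \sum_i (coef (sx i) u : R) *: y i.
have lf : linear f.
  move=> a u v; rewrite /f scaler_sumr -big_split; apply: eq_bigr => i _ /=.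
  by rewrite linearP scalerDl scalerA.
exists (linear_of lf), (codom y); split=> [u|x xxs].
  apply: in_sub_sum => i _; apply: in_subZ; apply: span_gen; exact: codom_f.
have [k ->] : exists k, x = tnth (in_tuple xs) k by apply/tnthP.
apply: inj_j; rewrite /= /f linear_sum jE.
apply/eqP; rewrite -subr_eq0 -sumrB; apply/eqP.
transitivity (- \sum_(z <- l) (\sum_i r k i * z.1 i) *: t z.2); last first.
  by rewrite big_seq big1 ?oppr0 // => z /lr ->; rewrite scale0r.
transitivity (- \sum_i r k i *: (\sum_(z <- l) z.1 i *: t z.2)).
  rewrite -sumrN; apply: eq_bigr => i _; rewrite linearZ yP -jE
    -[coef _ _]/(r k i).
  by rewrite -scalerBr /w addrAC subrr add0r scalerN.
congr (- _); under eq_bigr do rewrite scaler_sumr.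
rewrite exchange_big; apply: eq_bigr => z _ /=; rewrite scaler_suml.
by apply: eq_bigr => i _; rewrite scalerA.
Qed.

End FlatPurity.

(** * Transfinite exhaustion of a pure submodule *)

Section Telescope.
Variables (R : pzRingType) (P K : lmodType R) (j : {linear K -> P}).
Variables (s : nat -> seq K) (f : nat -> {linear P -> K}) (D : submodule K).
Hypothesis projP : projective P.
Hypothesis s_incr : forall i x, x \in s i -> x \in s i.+1.
Hypothesis f_fix : forall i x, x \in s i -> f i (j x) = x.
Hypothesis f_span : forall i u, span (fun y => y \in s i.+1) (f i u).
Hypothesis D_union : forall x, D x <-> exists i, span (fun y => y \in s i) x.

(** Put t_i = (1 - f_(i-1) j) ... (1 - f_0 j). Then t_(i+1) kills the span of
    s_i, so every x in D is the finite telescoping sum of the f_i (j (t_i x)).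
    This makes D a direct summand of a countable direct sum of copies of P. *)
Lemma telescope_projective : projective (subm D).
Proof.
pose T i x := span (fun y => y \in s i) x.
have s_mono i k x : (i <= k)%N -> x \in s i -> x \in s k.
  by move=> /subnK <-; elim: (k - i)%N => // m IH /IH; apply: s_incr.
have T_mono i k x : (i <= k)%N -> T i x -> T k x.
  by move=> ik; apply: span_mono => y; apply: s_mono.
pose t i x := iteri i (fun k y => y - f k (j y)) x.
have tlin i : linear (t i).
  elim: i => [//|i IH] a x y /=.
  by rewrite -!/(t i _) IH !linearP scalerDr addrACA.
have tT i k x : (k <= i)%N -> T i x -> T i (t k x).
  elim: k => [//|k IH] ki Tx /=; rewrite -/(t k x).
  apply: in_subB; first exact/IH/Tx/ltnW.
  apply: (T_mono k.+1) => //; exact: f_span.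
have t0 i k x : (i < k)%N -> T i x -> t k x = 0.
  move=> ik Tx; have : t i.+1 x = 0.
    rewrite /= -/(t i x); apply/eqP; rewrite subr_eq0 eq_sym; apply/eqP.
    exact: (span_eq (f := lin_comp (f i) j) (g := (idfun : {linear K -> K}))
      (f_fix (i := i)) (tT i i x (leqnn i) Tx)).
  move: ik => /subnK <-; elim: (k - i.+1)%N => [//|m IH] e.
  by rewrite addSn /= -/(t (m + i.+1) x) IH // !linear0 addr0.
have supp (x : subm D) : fin_supp (fun i => j (t i (incl x))).
  have /D_union[N TN] := inclP x; exists (iota 0 N.+1) => i.
  by rewrite mem_iota /= add0n -leqNgt => /t0 ->; rewrite ?linear0.
have [a x u y v xu yv i|x|u uP|sg sgP] := @linear_rel R (subm D) (dsum nat P)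
    (fun x u => forall i, coef i u = j (t i (incl x))).
- by rewrite !linearP xu yv tlin linearP.
- exact: (dsum_of (supp x)).
- apply: coef_inj => i; rewrite uP !linear0.
  by have := tlin i (-1) 0 0; rewrite scaler0 addr0 scaleN1r addNr => ->;
    rewrite linear0.
have FD i : exists F : {linear P -> subm D}, forall u, incl (F u) = f i u.
  by apply: corestrict => u; apply/D_union; exists i.+1.
have [F FP] := choice FD.
have [rho rhoP] := dsum_univ F.
apply: (@projective_retract _ _ _ sg rho); last exact: dsum_projective.
move=> x; apply: incl_inj; have /D_union[N TN] := inclP x.
rewrite (@dsum_decomp _ _ _ (sg x) (iota 0 N.+1)) ?iota_uniq // => [|i];
  last first.
  by rewrite mem_iota /= add0n -leqNgt sgP => /t0 ->; rewrite ?linear0.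
rewrite !linear_sum.
under eq_bigr do rewrite rhoP FP sgP.
rewrite -[iota _ _]/(index_iota 0 N.+1).
transitivity (- \sum_(0 <= i < N.+1) (t i.+1 (incl x) - t i (incl x))).
  rewrite -sumrN; apply: eq_bigr => i _.
  by rewrite opprB /= -/(t i _) opprB addrC subrK.
by rewrite telescope_sumr // opprB (t0 N N.+1) // subr0.
Qed.

End Telescope.

Section Exhaustion.
Variables (R : pzRingType) (n : nat) (P K : lmodType R) (j : {linear K -> P}).
Hypotheses (silpn : silp_le R n) (projP : projective P) (inj_j : injective j).
Variables (f : seq K -> {linear P -> K}) (Y : seq K -> seq K).
Hypothesis f_span : forall xs u, span (fun y => y \in Y xs) (f xs u).
Hypothesis f_fix : forall xs x, x \in xs -> f xs (j x) = x.

(** Since Y xs spans the image of a map that fixes xs, the span of a saturated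
    set is again pure in P. *)
Inductive saturate (S : K -> Prop) : K -> Prop :=
  | saturate_in x : S x -> saturate S x
  | saturate_step xs y : (forall x, x \in xs -> saturate S x) -> y \in Y xs ->
    saturate S y.

Definition pure_hull (S : K -> Prop) : submodule K := span (saturate S).

Lemma saturate_mono (S S' : K -> Prop) : (forall x, S x -> S' x) ->
  forall x, saturate S x -> saturate S' x.
Proof.
by move=> SS x; elim=> [y /SS|xs y _ IH yY];
  [apply: saturate_in | apply: saturate_step yY].
Qed.

Lemma pure_hull_mono (S S' : K -> Prop) : (forall x, S x -> S' x) ->
  forall x, pure_hull S x -> pure_hull S' x.
Proof. by move=> SS; apply: span_mono; apply: saturate_mono. Qed.

Lemma pure_hull_in (S : K -> Prop) x : S x -> pure_hull S x.
Proof. by move=> Sx; apply/span_gen/saturate_in. Qed.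

(** The list with code m of entries of s, by position; all lists occur in this
    way, and only finitely many are needed at each stage. *)
Definition word (s : seq K) (m : nat) : seq K :=
  [seq nth 0 s k | k <- odflt [::] (unpickle m) & (k < size s)%N].

Fixpoint stage (C : seq K) (i : nat) : seq K :=
  if i is i'.+1 then
    let s := stage C i' in s ++ Y s ++ flatten
      [seq Y (word s m) | m <- iota 0 i]
  else C.

Lemma stageS C i : stage C i.+1 = stage C i ++ Y (stage C i) ++
  flatten [seq Y (word (stage C i) m) | m <- iota 0 i.+1].
Proof. by []. Qed.

Lemma mem_stageS C i x : (x \in stage C i.+1) =
  [|| x \in stage C i, x \in Y (stage C i) |
      x \in flatten [seq Y (word (stage C i) m) | m <- iota 0 i.+1]].
Proof. by rewrite stageS mem_cat [X in _ || X]mem_cat. Qed.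

Lemma stage_cat C i k : (i <= k)%N -> exists s, stage C k = stage C i ++ s.
Proof.
move=> /subnK <-; elim: (k - i)%N => [|m [s IH]]; first by exists [::];
  rewrite cats0.
by rewrite addSn stageS [in X in X ++ _]IH -catA; eexists.
Qed.

Lemma stage_mono C i k x : (i <= k)%N -> x \in stage C i -> x \in stage C k.
Proof. by move=> /(stage_cat C)[s ->]; rewrite mem_cat => ->. Qed.

Lemma saturate_stage C x : saturate (fun y => y \in C) x ->
  exists i, x \in stage C i.
Proof.
elim=> [y yC|xs y _ IH yY]; first by exists 0%N.
have [i xsi] : exists i, {subset xs <= stage C i}.
  elim: xs IH {yY} => [|x' xs IHxs] IH; first by exists 0%N.
  have [i iP] := IHxs (fun z zxs => IH z (mem_behead (s := x' :: xs) zxs)).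
  have [k kP] := IH x' (mem_head _ _).
  exists (maxn i k) => z; rewrite inE => /orP[/eqP ->|/iP zi].
    exact: stage_mono (leq_maxr _ _) kP.
  exact: stage_mono (leq_maxl _ _) zi.
pose w := [seq index z (stage C i) | z <- xs].
pose k := maxn i (pickle w); exists k.+1; rewrite mem_stageS.
suff -> : y \in flatten [seq Y (word (stage C k) m) | m <- iota 0 k.+1] by
  rewrite !orbT.
apply/flattenP; exists (Y xs) => //; apply/mapP; exists (pickle w).
  by rewrite mem_iota add0n ltnS; apply: leq_maxr.
have [s es] := stage_cat C (leq_maxl i (pickle w) : (i <= k)%N).
congr Y; rewrite /word pickleK /= (_ : [seq l <- w | _] = w); last first.
  apply/all_filterP/allP => _ /mapP[z /xsi zi ->].
  by rewrite es size_cat (leq_trans _ (leq_addr _ _)) // index_mem.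
rewrite -map_comp -[LHS]map_id; apply/eq_in_map => z /xsi zi /=.
by rewrite es nth_cat index_mem zi nth_index.
Qed.

Lemma stage_saturate C i x : x \in stage C i -> saturate (fun y => y \in C) x.
Proof.
elim: i x => [|i IH] x; first exact: saturate_in.
rewrite mem_stageS => /or3P[/IH //|xY|/flattenP[_ /mapP[m _ ->] xY]].
  exact: saturate_step IH xY.
apply: saturate_step xY => _ /mapP[k + ->]; rewrite mem_filter => /andP[ks _].
exact/IH/mem_nth.
Qed.

(** The stages enumerate the saturation, and the maps fixing them telescope. *)
Lemma pure_hull_finite (C : seq K) : pd_le (subm (pure_hull (fun y => y \in C)))
  n.
Proof.
apply: (@pd_le_leq _ 0) => //; apply/pd_le0.
apply: (@telescope_projective _ _ _ j (stage C) (fun i => f (stage C i))) => //.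
- by move=> i x; apply: stage_mono.
- by move=> i x; apply: f_fix.
- move=> i u; move: (@f_span (stage C i) u); apply: span_mono => y yY.
  by rewrite mem_stageS yY orbT.
move=> x; split=> [|[i]]; last by apply: span_mono => y; apply: stage_saturate.
have U0 : exists i, span (fun y => y \in stage C i) 0 by exists 0%N;
  apply: in_sub0.
have UP a y z : (exists i, span (fun y => y \in stage C i) y) ->
    (exists i, span (fun y => y \in stage C i) z) ->
    exists i, span (fun y => y \in stage C i) (a *: y + z).
  move=> [i yi] [k zk]; exists (maxn i k).
  apply: in_subP; [move: yi|move: zk]; apply: span_mono => w; apply: stage_mono.
    exact: leq_maxl.
  exact: leq_maxr.
apply: (@span_min _ _ _ (Submodule U0 UP)) => y /saturate_stage[i yi].
by exists i; apply: span_gen.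
Qed.

Definition subquot (U U' : submodule K) : lmodType R :=
  quom (preim_sub (incl : {linear subm U' -> K}) U).

(** U' / U is the kernel of the surjection from P / U to P / U'. Hence its
    projective dimension is finite, and then at most n. *)
Lemma subquot_pd_le (U U' : submodule K) : (forall x, U x -> U' x) ->
  pd_le (subm U) n -> pd_le (subm U') n -> pd_le (subquot U U') n.
Proof.
move=> UU' pdU pdU'; pose i (V : submodule K) :=
  lin_comp j (incl : {linear subm V -> K}).
have inji V : injective (i V) by move=> x y /inj_j/incl_inj.
have pdPV V : pd_le (subm V) n -> pd_le (quom (im_sub (i V))) n.+1.
  by move/(pd_le_shift _ projP (ses_im (inji V))).
have imi V x : im_sub (i V) (j x) <-> V x.
  split=> [[y /inj_j <-]|/incl_onto[y yx]]; first exact: inclP.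
  by exists y; rewrite /= yx.
have [||a aP] := @factor_surj _ _ _ _
  (proj (preim_sub (incl : {linear subm U' -> K}) U))
   (lin_comp (proj (im_sub (i U))) (i U')).
- exact: proj_surj.
- by move=> x /proj_eq0 /= Ux; apply/proj_eq0/imi.
have [||b bP] := @factor_surj _ _ _ _ (proj (im_sub (i U)))
  (proj (im_sub (i U'))).
- exact: proj_surj.
- move=> x /proj_eq0[y yx]; apply/proj_eq0; rewrite -yx.
  by apply/imi/UU'/inclP.
have ex : ses a b.
  split=> [|y|y].
  - apply: inj_linear => x; have [y <-] := proj_surj _ x; rewrite aP.
    by move=> /proj_eq0/imi Uy; apply/proj_eq0.
  - by have [x <-] := proj_surj _ y; exists (proj _ x); rewrite bP.
  - have [x <-] := proj_surj _ y; rewrite bP; split=> [/proj_eq0[u ux]|[u]].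
      by exists (proj _ u); rewrite aP /= -ux.
    have [v <-] := proj_surj _ u; rewrite aP => e.
    have : proj (im_sub (i U)) (x - i U' v) = 0 by rewrite linearB -e subrr.
    move=> /proj_eq0[w wx]; apply/proj_eq0.
    rewrite -[x](subrK (i U' v)) -wx; apply: (@in_subD _ _ (im_sub (i U'))).
      by apply/imi/UU'/inclP.
    by exists v.
apply: (silp_pd_le (k := n.+1) silpn) => N.
by apply: (ext_zero_sub ex); [apply: pdPV | apply/pd_leS/pdPV].
Qed.

Section Extend.
Variables (B N : lmodType R) (q : {linear B -> K}) (U U' : submodule K).
Hypotheses (UU' : forall x, U x -> U' x)
  (qU' : forall x, U' x -> exists b, q b = x).
Hypothesis extN : ext1_zero (subquot U U') N.

(** One step of the filtration: the preimages of U and U' under q differ by U' /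
    U. *)
Lemma extend_graph (G : set (B * N)) : graph_linear G ->
  (forall b, dom G b <-> U (q b)) ->
  exists G' : set (B * N), [/\ graph_linear G', (G `<=` G')%classic &
    forall b, dom G' b <-> U' (q b)].
Proof.
move=> [linG sgG] domG.
pose A0 := preim_sub q U; pose B0 := preim_sub q U'.
have [x|i iP] := corestrict (f := incl : {linear subm A0 -> B}) (D := B0).
  exact/UU'/(inclP x).
have [x|q' q'P] := corestrict (f := lin_comp q (incl : {linear subm B0 -> B}))
  (D := U').
  exact: (inclP x).
have [a x y x' y'|x|y|h hP] := @linear_rel R (subm A0) N
  (fun x y => G (incl x, y)).
- by rewrite linearP; apply: linG.
- exact/domG/(inclP x).
- by rewrite linear0; apply: sgG.
have ex : ses i (lin_comp (proj (preim_sub (incl : {linear subm U' -> K}) U))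
  q').
  split=> [x y|y|x].
  - by move=> /(congr1 incl); rewrite !iP => /incl_inj.
  - have [u <-] := proj_surj _ y; have [b bu] := qU' (inclP u).
    have [|b' b'b] := @incl_onto _ _ B0 b; first by rewrite /= bu; apply: inclP.
    by exists b'; congr (proj _ _); apply: incl_inj; rewrite q'P /= b'b.
  - split=> [/proj_eq0 /=|[y <-]]; last first.
      by apply/proj_eq0 => /=; rewrite q'P /= iP; apply: (inclP y).
    rewrite q'P /= => /(@incl_onto _ _ A0)[y yx]; exists y.
    by apply: incl_inj; rewrite iP.
have [g gP] := extN ex h.
exists (fun p => exists b, p = (incl b, g b)); split.
- split=> [a x y x' y' [b [-> ->]] [b' [-> ->]]|y [b []]].
    by exists (a *: b + b'); rewrite !linearP.
  by rewrite -[X in X = _](linear0 (incl : {linear subm B0 -> B})) =>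
    /incl_inj <- ->; rewrite linear0.
- move=> [b y] Gby.
  have [|a ab] := @incl_onto _ _ A0 b; first by apply/domG; exists y.
  exists (i a); rewrite iP ab gP; congr pair; apply/eqP; rewrite -subr_eq0.
  apply/eqP/sgG; have := linG (-1) _ _ _ _ (hP a) Gby.
  by rewrite ab !scaleN1r addNr addrC.
- move=> b; split=> [[y [c [-> _]]]|/(@incl_onto _ _ B0)[c cb]];
  first exact: (inclP c).
  by exists (g c), c; rewrite cb.
Qed.

End Extend.

(** Saturation is finitary, so it commutes with unions of chains. *)
Lemma pure_hull_chain (F : (K -> Prop) -> Prop) (C : K -> Prop) :
  (exists J, F J) ->
  (forall J J', F J -> F J' -> (forall x, J x -> J' x) \/
    (forall x, J' x -> J x)) ->
  forall x, pure_hull (fun y => (exists2 J, F J & J y) \/ C y) x ->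
  exists2 J, F J & pure_hull (fun y => J y \/ C y) x.
Proof.
move=> [J0 FJ0] totF.
have join J J' : F J -> F J' -> exists2 L, F L &
    (forall x, J x \/ C x -> L x \/ C x)
      /\ (forall x, J' x \/ C x -> L x \/ C x).
  by move=> FJ FJ'; case: (totF _ _ FJ FJ') => s; [exists J'|exists J] => //;
    split=> x [Jx|Cx]; by [left; auto|right].
have genF x : saturate (fun y => (exists2 J, F J & J y) \/ C y) x ->
    exists2 J, F J & saturate (fun y => J y \/ C y) x.
  elim=> [y [[J FJ Jy]|Cy]|xs y _ IH yY].
  - by exists J => //; apply: saturate_in; left.
  - by exists J0 => //; apply: saturate_in; right.
  suff [J FJ JP] : exists2 J, F J & forall z, z \in xs ->
    saturate (fun y => J y \/ C y) z.
    by exists J => //; apply: saturate_step yY.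
  elim: xs IH {yY} => [|z xs IHxs] IH; first by exists J0.
  have [J FJ JP] := IHxs (fun w wxs => IH w (mem_behead (s := z :: xs) wxs)).
  have [J' FJ' J'P] := IH z (mem_head _ _).
  have [L FL [JL J'L]] := join _ _ FJ FJ'; exists L => // w.
  by rewrite inE => /orP[/eqP ->|/JP];
    [apply: saturate_mono J'P | apply: saturate_mono].
have U0 : exists2 J, F J & pure_hull (fun y => J y \/ C y) 0.
  by exists J0 => //; apply: in_sub0.
have UP a y z : (exists2 J, F J & pure_hull (fun y => J y \/ C y) y) ->
    (exists2 J, F J & pure_hull (fun y => J y \/ C y) z) ->
    exists2 J, F J & pure_hull (fun y => J y \/ C y) (a *: y + z).
  move=> [J FJ Jy] [J' FJ' J'z]; have [L FL [JL J'L]] := join _ _ FJ FJ'.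
  exists L => //; apply: in_subP; first exact: pure_hull_mono Jy.
  exact: pure_hull_mono J'z.
apply: (@span_min _ _ _ (Submodule U0 UP)) => y /genF[J FJ Jy].
by exists J => //; apply: span_gen.
Qed.

Variable le : rel K.
Hypothesis le_wo : well_order le.

Lemma le_min (A : K -> Prop) : (exists x, A x) ->
  exists z, A z /\ forall x, A x -> le z x.
Proof.
move=> [x Ax]; have [|z [[zA minz] _]] := le_wo (A := fun y => `[<A y>]).
  by exists x; apply/asboolP.
by exists z; split=> [|y Ay]; [exact/asboolP | apply: minz; apply/asboolP].
Qed.

Lemma le_total x y : le x y \/ le y x.
Proof.
have [|z [[->|->] minz]] := @le_min (fun z => z = x \/ z = y);
  first by exists x; left.
  by left; apply: minz; right.
by right; apply: minz; left.
Qed.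

Lemma le_anti x y : le x y -> le y x -> x = y.
Proof.
move=> xy yx; have lexx z : le z z by case: (le_total z z).
have [|z [_ uniqz]] := le_wo (A := pred2 x y); first by exists x;
  rewrite !inE eqxx.
rewrite -(uniqz x) ?(uniqz y) //; split; rewrite ?inE ?eqxx ?orbT // => w.
  by rewrite !inE => /orP[/eqP->|/eqP->].
by rewrite !inE => /orP[/eqP->|/eqP->].
Qed.

Lemma le_trans x y z : le x y -> le y z -> le x z.
Proof.
move=> xy yz.
have [|w [[->|[->|->]] minw]] := @le_min (fun w => w = x \/ w = y \/ w = z).
- by exists x; left.
- by apply: minw; right; right.
- by rewrite (le_anti xy) //; apply: minw; left.
- by rewrite -(le_anti yz) //; apply: minw; right; left.
Qed.

Definition initial (J : K -> Prop) := forall x y, le x y -> J y -> J x.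
Definition segment (v : K) : K -> Prop := fun x => ~ le v x.
Definition adjoin (J : K -> Prop) (C : seq K) : K -> Prop :=
  fun x => J x \/ x \in C.
(** The finite set C absorbs successor steps: the hull of [segment v], v and C
    is the hull of [segment v] and [v :: C]. *)
Definition good (J : K -> Prop) := forall C : seq K, pd_le
  (subm (pure_hull (adjoin J C))) n.

Lemma initial_total J J' : initial J -> initial J' ->
  (forall x, J x -> J' x) \/ (forall x, J' x -> J x).
Proof.
move=> iJ iJ'; have [|/existsNP[x /not_implyP[Jx nJ'x]]] :=
  pselect (forall x, J x -> J' x).
  by left.
right=> y J'y; have [xy|yx] := le_total x y; last exact: iJ yx Jx.
by case: nJ'x; apply: iJ' xy J'y.
Qed.

Lemma initial_gap I J : initial I -> initial J -> (forall x, J x -> I x) ->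
  ~ (forall x, I x -> J x) -> exists v, [/\ I v, ~ J v & J = segment v].
Proof.
move=> iI iJ JI /existsNP[w /not_implyP[Iw nJw]].
have [|v [[Iv nJv] minv]] := @le_min (fun x => I x /\ ~ J x); first by exists w.
exists v; split=> //; apply/funext => x; apply/propext; split=> [Jx vx|nvx].
  by apply: nJv; apply: iJ vx Jx.
have [vx|xv] := le_total v x; first by case: nvx.
by apply: contrapT => nJx; apply/nvx/minv; split=> //; apply: iI xv Iv.
Qed.

(** The lemma of Auslander and Eklof. A homomorphism into a cosyzygy of order n
    is extended along the hulls of the initial segments of I. A maximal partial
    extension is defined on all of it: otherwise the least missing element v of
    I gives a larger hull, and the quotient of the two hulls has projective
    dimension at most n because [segment v] is good. *)
Lemma good_initial I : initial I -> (forall v, I v -> good (segment v)) ->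
  good I.
Proof.
move=> iI goodI C N A B i q ex h0; set N' := iter n _ _ in h0 *.
pose D J := pure_hull (adjoin J C).
pose q' := lin_comp (incl : {linear subm (D I) -> K}) q.
have [inji sq exq] := ex.
have D_mono J J' : (forall x, J x -> J' x) -> forall x, D J x -> D J' x.
  by move=> JJ'; apply: pure_hull_mono => x [/JJ'|]; [left|right].
have qD J : (forall x, J x -> I x) -> forall x, D J x -> exists b, q' b = x.
  move=> JI x /(D_mono _ _ JI)/incl_onto[u <-].
  by have [b <-] := sq u; exists b.
have emptyC : adjoin (fun _ => False) C = (fun y => y \in C).
  by apply/funext => x; apply/propext; split=> [[]//|]; right.
have pdempty : pd_le (subm (D (fun _ => False))) n by rewrite /D emptyC;
  apply: pure_hull_finite.
pose Z := ker_sub (idfun : {linear K -> K}).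
have pdZ : pd_le (subm Z) n.
  apply: (@pd_le_leq _ 0) => //; apply/pd_le0.
  apply: (@projective_retract _ _ _ (zero_map (subm Z) P) (zero_map P (subm Z)))
    => // x.
  by rewrite [RHS]zero_moduleE.
pose Gf : set (B * N') := fun p => exists a, p = (i a, h0 a).
have linGf : graph_linear Gf.
  split=> [a x y x' y' [u [-> ->]] [v [-> ->]]|y [u []]].
    by exists (a *: u + v); rewrite !linearP.
  by rewrite -[X in X = _](linear0 i) => /inji <- ->; rewrite linear0.
have domGf b : dom Gf b <-> Z (q' b).
  split=> [[y [a [-> _]]]|qb0]; first by rewrite /= (ses_comp0 _ ex) linear0.
  have /exq[a ab] : q b = 0 by apply: incl_inj; rewrite linear0.
  by exists (h0 a), a; rewrite ab.
have ZD x : Z x -> D (fun _ => False) x by move=> x0; rewrite [x]x0;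
  apply: in_sub0.
have qD0 x : D (fun _ => False) x -> exists b, q' b = x by apply: qD.
have ext0 := extend_graph ZD qD0 (@subquot_pd_le _ _ ZD pdZ pdempty N) linGf
  domGf.
have [G0 [linG0 GfG0 domG0]] := ext0.
pose Dom (E : set B) := exists J, [/\ initial J, forall x, J x -> I x &
  forall b, E b <-> D J (q' b)].
have chainD (CC : set (set B)) : (CC !=set0)%classic ->
  (forall E, CC E -> Dom E) ->
    total_on CC subset -> Dom (\bigcup_(E in CC) E)%classic.
  move=> [E0 CE0] CD _.
  pose F J := [/\ initial J, forall x, J x ->
    I x & exists2 E, CC E & forall b, E b <-> D J (q' b)].
  exists (fun x => exists2 J, F J & J x); split.
  - by move=> x y xy [J [iJ JI EJ] Jy]; exists J => //; apply: iJ xy Jy.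
  - by move=> x [J [_ JI _] /JI].
  move=> b; split=> [[E CE Eb]|].
    have [J [iJ JI JE]] := CD _ CE; have FJ : F J by split=> //; exists E.
    by have /JE := Eb; apply: D_mono => x Jx; exists J.
  move=> Db; have [||J [_ _ [E CE JE]] DJ] := pure_hull_chain _ _ Db.
  - by have [J [iJ JI JE]] := CD _ CE0; exists J; split=> //; exists E0.
  - by move=> J J' [iJ _ _] [iJ' _ _]; apply: initial_total.
  by exists E => //; apply/JE.
have [||G [G0G linG [J [iJ JI domG]]]|h hP] :=
  zorn_extend (Dom := Dom) (G0 := G0) chainD.
- by apply: GfG0; exists 0; rewrite !linear0.
- by split=> //; exists (fun _ => False); split.
- (* J is first enlarged as far as its hull stays the same: otherwise adjoining
     v could leave the domain unchanged. *)
  pose F J' := [/\ initial J', forall x, J' x -> I x & forall x, D J' x ->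
    D J x].
  pose J1 x := exists2 J', F J' & J' x.
  have J1i : initial J1 by move=> x y xy [J' [iJ' J'I J'D] J'y];
    exists J' => //; apply: iJ' xy J'y.
  have J1I x : J1 x -> I x by move=> [J' [_ + _]]; apply.
  have J1D x : D J1 x -> D J x.
    move=> D1x; have [||J' [_ _ J'D] DJ'] := pure_hull_chain _ _ D1x;
      last exact: J'D.
    - by exists J; split.
    - by move=> L L' [iL _ _] [iL' _ _]; apply: initial_total.
  have JD1 x : D J x -> D J1 x by apply: D_mono => y Jy; exists J.
  have domG1 b : dom G b <-> D J1 (q' b) by rewrite domG; split=> [/JD1|/J1D].
  have [IJ1|nIJ1] := pselect (forall x, I x -> J1 x).
    left=> b; apply/domG1; apply: (D_mono _ _ IJ1); exact: (inclP (q b)).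
  right; have [v [Iv nJ1v J1E]] := initial_gap iI J1i J1I nIJ1.
  pose J2 x := J1 x \/ x = v.
  have J2i : initial J2.
    move=> x y xy [J1y|yv]; first by left; apply: J1i xy J1y.
    have [xv|xv] := eqVneq x v; first by right.
    by left; rewrite J1E => vx; case/eqP: xv; apply: le_anti => //; rewrite -yv.
  have J2I x : J2 x -> I x by move=> [/J1I|->].
  have D12 x : D J1 x -> D J2 x by apply: D_mono; left.
  have pd2 : pd_le (subm (D J2)) n.
    have -> : D J2 = pure_hull (adjoin (segment v) (v :: C)).
      rewrite /D; congr pure_hull; apply/funext => x; apply/propext.
      rewrite -J1E /adjoin /J2 inE; split.
        by case=> [[J1x|->]|xC]; [left | right; rewrite eqxx | right;
          rewrite xC orbT].
      by case=> [J1x|/orP[/eqP ->|xC]]; [left; left | left; right | right].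
    exact: (goodI _ Iv (v :: C)).
  have pd1 : pd_le (subm (D J1)) n by rewrite /D J1E; apply: (goodI _ Iv C).
  have [G' [linG' GG' domG']] :=
    extend_graph D12 (qD _ J2I) (@subquot_pd_le _ _ D12 pd1 pd2 N) linG domG1.
  exists G'; split=> //; first by split=> //;
    [apply: subset_trans GG' | exists J2; split].
  move=> G'G; apply: nJ1v; exists J2; last by right.
  split=> // x D2x; have [b bx] := qD _ J2I _ D2x.
  rewrite -bx in D2x *; have /domG'[y /G'G Gby] := D2x.
  by apply/domG; exists y.
by exists h => a; apply: hP; apply: GfG0; exists a.
Qed.

Lemma pure_submodule_pd_le : pd_le K n.
Proof.
have good_seg v : good (segment v).
  apply: contrapT => nv; have [|w [nw minw]] :=
    @le_min (fun v => ~ good (segment v)).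
    by exists v.
  apply: nw; apply: good_initial => [x y xy|u uw].
    by move=> nwy wx; apply: nwy; apply: le_trans wx xy.
  by apply: contrapT => /minw.
have goodT : good (fun _ => True) by apply: good_initial.
have all_in x : pure_hull (adjoin (fun _ => True) [::]) x by apply:
  pure_hull_in; left.
have [s sP] := corestrict (f := (idfun : {linear K -> K})) all_in.
by move=> N; apply: (ext1_retract_l (s := s) (r := incl) sP); apply: goodT.
Qed.

End Exhaustion.

(** * Finite flat dimension of injectives forces silp = spli *)

Lemma ses_chr (R S : pzRingType) (phi : antimorphism R S) (A B C : lmodType S)
    (i : {linear A -> B}) (q : {linear B -> C}) :
  ses i q -> ses (chr_map phi q) (chr_map phi i).
Proof.
move=> [inji sq ex]; split; first exact: chr_map_inj.
  exact: chr_map_surj.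
exact: chr_map_exact.
Qed.

Lemma flat_resolution_id_le (R : pzRingType) (M : lmodType R) m :
  resolution (@flat R) M m -> id_le (chr (of_conv R) M) m.
Proof.
elim: m M => [|m IH] M.
  move=> /resolution0_inv[F [e [/flat_chr_injective injF inje se]]];
    apply/id_le0.
  apply: (injective_iso (e := chr_map (of_conv R) e)) injF;
    first exact: chr_map_inj.
  exact: chr_map_surj.
move=> /resolutionS_inv[K [F [i [q [/flat_chr_injective injF ex /IH idK]]]]].
exact/(id_le_shift _ injF (ses_chr _ ex)).
Qed.

Section Jensen.
Variables (R S : pzRingType) (phi : antimorphism R S) (psi : antimorphism S R).
Hypotheses (phiK : cancel phi psi) (psiK : cancel psi phi).

(** Jensen's theorem; the hypothesis on the character module of B is flatness.
    *)
Lemma flat_pd_le n (B : lmodType R) : silp_le R n ->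
  injective_module (chr psi B) -> pd_le B n.
Proof.
move=> silpn injB; have ex := ses_syz B; have [injs _ _] := ex.
have [f fP] := choice (flat_pure phiK ex injB); have [Y YP] := choice fP.
have [le le_wo] := well_ordering_principle (syz B).
have pdK : pd_le (syz B) n.
  apply: (pure_submodule_pd_le silpn (free_projective (R := R) (X := B)) injs
    (f := f) (Y := Y)) le_wo.
    by move=> xs u; have [+ _] := YP xs; apply.
  by move=> xs x; have [_] := YP xs; apply.
apply: (silp_pd_le (k := n.+1) silpn).
by apply/(pd_le_shift _ _ ex) => //; apply: free_projective.
Qed.

(** The dual of a projective resolution of B is an injective coresolution of
    B^+; hence the dual of the m-th syzygy of B is an m-th cosyzygy of B^+. *)
Lemma chr_syz m (B : lmodType R) : id_le (chr psi B) m ->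
  injective_module (chr psi (iter m (@syz R) B)).
Proof.
elim: m B => [|m IH] B; first by move/id_le0.
move=> idB; rewrite iterSr; apply: IH.
by apply/(id_le_shift _ _ (ses_chr psi (ses_syz B))) => //;
  apply: chr_projective phiK psiK _ _; apply: free_projective.
Qed.

Lemma pd_le_syz m n (B : lmodType R) : pd_le (iter m (@syz R) B) n ->
  pd_le B (m + n).
Proof.
elim: m B => [//|m IH] B; rewrite iterSr => /IH pd.
by apply/(pd_le_shift _ _ (ses_syz B)) => //; apply: free_projective.
Qed.

(** A flat syzygy of E has projective dimension at most n, so E has finite
    projective dimension, which n bounds. *)
Lemma spli_le_of_silp_le n :
  (forall E : lmodType R, injective_module E -> exists m, id_le (chr psi E) m)
    ->
  silp_le R n -> spli_le R n.
Proof.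
move=> fdE silpn E injE; have [m /chr_syz injB] := fdE E injE.
exact: silp_pd_le silpn (pd_le_syz (flat_pd_le silpn injB)).
Qed.

End Jensen.

Lemma silp_eq_spli (R : pzRingType) :
  (forall E : lmodType R, injective_module E -> finite_flat_dim E) ->
  (exists n, silp R = Some n) -> silp R = spli R.
Proof.
move=> fdE [n]; rewrite silpE spliE => /leastP[silpn _]; apply: least_ext => k.
split=> [|splik P projP]; last exact: spli_id_le splik (silpn _ projP).
apply: (@spli_le_of_silp_le R R^c (to_conv R) (of_conv R)) => // E /fdE[m res].
by exists m; apply: flat_resolution_id_le.
Qed.

(** * Noetherian rings *)

Section FinitelyGenerated.
Variable R : pzRingType.

Definition fin_gen (M : lmodType R) (D : M -> Prop) :=
  exists xs : seq M, forall x, D x <-> span (fun y => y \in xs) x.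

Definition noeth_mod (M : lmodType R) := forall D : submodule M, fin_gen D.

Lemma fin_gen_ext (M N : lmodType R) (f : {linear M -> N}) (D : submodule M)
    (E : submodule N) :
  (forall x, D x -> E (f x)) -> (forall y, E y -> exists2 x, D x & f x = y) ->
  fin_gen E -> fin_gen (fun x => D x /\ f x = 0) -> fin_gen D.
Proof.
move=> DE ED [ys ysP] [zs zsP].
have [xs xsD xsy] : exists2 xs, (forall x, x \in xs -> D x)
  & [seq f x | x <- xs] = ys.
  have ysE y : y \in ys -> E y by move=> yys; apply/ysP/span_gen.
  elim: ys ysE {ysP} => [|y ys IH] ysE; first by exists [::].
  have [xs xsD <-] := IH (fun z zys => ysE z (mem_behead (s := y :: ys) zys)).
  have [x Dx <-] := ED y (ysE y (mem_head _ _)); exists (x :: xs) => // z.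
  by rewrite inE => /orP[/eqP ->|/xsD].
exists (xs ++ zs) => x; split; last first.
  apply: span_min => y; rewrite mem_cat => /orP[/xsD //|yzs].
  by have /zsP[] : span (fun y => y \in zs) y by apply: span_gen.
move=> Dx; have /ysP := DE x Dx; move=> fx.
have im : im_sub (lin_comp f
  (incl : {linear subm (span (fun y => y \in xs)) -> M})) (f x).
  apply: span_min fx => y; rewrite -xsy => /mapP[z zxs ->].
  have [w wz] := incl_onto (D := span (fun y => y \in xs)) (x := z)
    (span_gen zxs).
  by exists w; rewrite /= wz.
have [w wx] := im; rewrite /= in wx.
have [w' wE] : exists w', w' = incl w by eexists.
have w'xs : span (fun y => y \in xs) w' by rewrite wE; apply: inclP.
have Dw' : D w' by apply: span_min w'xs => y; apply: xsD.
rewrite -(subrK w' x); apply: in_subD; last first.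
  by move: w'xs; apply: span_mono => y; rewrite mem_cat => ->.
have /zsP : D (x - w') /\ f (x - w') = 0.
  by split; [apply: in_subB | rewrite linearB wE wx subrr].
by apply: span_mono => y; rewrite mem_cat orbC => ->.
Qed.

Lemma noeth_ext (A B C : lmodType R) (i : {linear A -> B}) (q : {linear B -> C})
  :
  ses i q -> noeth_mod A -> noeth_mod C -> noeth_mod B.
Proof.
move=> [inji sq ex] noA noC D.
pose qi := lin_comp q (incl : {linear subm D -> B}).
apply: (@fin_gen_ext _ _ q D (im_sub qi)).
- by move=> x /incl_onto[y yx]; exists y; rewrite /= yx.
- by move=> y [x xy]; exists (incl x) => //; apply: inclP.
- exact: noC.
have [xs xsP] := noA (preim_sub i D).
exists [seq i x | x <- xs] => x; split.
  move=> [Dx /ex[a ax]]; have /xsP aspan : preim_sub i D a by rewrite /= ax.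
  rewrite -ax; apply: (span_min
    (D := preim_sub i (span (fun y => y \in [seq i x | x <- xs])))) aspan =>
    y yxs.
  by apply: span_gen; apply: map_f.
have P0 : D 0 /\ q 0 = 0 by split; [apply: in_sub0 | apply: linear0].
have PP a y z : D y /\ q y = 0 -> D z /\ q z = 0 ->
  D (a *: y + z) /\ q (a *: y + z) = 0.
  by move=> [Dy qy] [Dz qz]; split;
    [apply: in_subP | rewrite linearP qy qz scaler0 addr0].
apply: (span_min (D := Submodule P0 PP)) => y /mapP[a axs ->] /=.
split; last by apply/ex; exists a.
by have /xsP : span (fun y => y \in xs) a by apply: span_gen.
Qed.

Lemma noeth_pow n : noeth_mod R^o -> noeth_mod (fpow R n).
Proof.
move=> noR; elim: n => [|n IH] => [D|].
  exists [::] => x; have -> : x = 0 by apply/funext => -[].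
  by split=> _; apply: in_sub0.
have lq : linear (fun v : fpow R n.+1 => v ord0 : R^o) by [].
have li : linear (fun v : fpow R n =>
  (fun k => if unlift ord0 k is Some k' then v k' else 0) : fpow R n.+1).
  move=> a u v; apply/funext => k.
  rewrite -[RHS]/(a *: (if unlift ord0 k is Some k' then u k' else 0) +
    (if unlift ord0 k is Some k' then v k' else 0)).
  by case: (unlift ord0 k) => //; rewrite scaler0 addr0.
apply: (@noeth_ext (fpow R n) (fpow R n.+1) R^o (linear_of li) (linear_of lq))
  => //.
split=> [u v /= uv|r|v].
- by apply/funext => k; have :=
  congr1 (fun w : fpow R n.+1 => w (fintype.lift ord0 k)) uv; rewrite !liftK.
- by exists (fun _ => r).
- split=> [/= v0|[u <-] /=]; last by rewrite unlift_none.
  exists (fun k => v (fintype.lift ord0 k)); apply/funext => k /=.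
  by case: unliftP => [k' ->|->].
Qed.

End FinitelyGenerated.

Notation noetherian R := (noeth_mod (R^o : lmodType R)).

Section FiniteAlgebra.
Variables (k T : pzRingType) (phi : k -> T) (n : nat) (pi : fpow k n -> T).
Hypotheses (piB : zmod_morphism pi)
  (piZ : forall a c, pi (a *: c) = phi a * pi c).
Hypothesis (spi : surj pi).

(** Submodules are pulled back along pi from the regular module of T to a finite
    power of k. Applied to R and to R^c, this treats the left and the right
    ideals of an algebra R alike. *)
Lemma noetherian_finite : noetherian k -> noetherian T.
Proof.
move=> nok D; have pi0 : pi 0 = 0 by rewrite -(subrr 0) piB subrr.
have piD x y : pi (x + y) = pi x + pi y.
  by rewrite -{1}[y]opprK piB -[- y]sub0r piB pi0 sub0r opprK.
have pull (E : submodule (T^o : lmodType T)) :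
    exists E' : submodule (fpow k n), forall c, E' c <-> E (pi c).
  have E0 : E (pi 0) by rewrite pi0; apply: in_sub0.
  have EP a x y : E (pi x) -> E (pi y) -> E (pi (a *: x + y)).
    by move=> Ex Ey; rewrite piD piZ; apply: (in_subP (s := E) (phi a)).
  by exists (@Submodule _ (fpow k n) (fun c => E (pi c)) E0 EP).
have [D' D'P] := pull D; have [cs csP] := @noeth_pow _ n nok D'.
exists [seq (pi c : T^o) | c <- cs] => x; have [c <-] := spi x; split.
  move=> /D'P/csP; have [E' E'P] :=
    pull (span (fun y : T^o => y \in [seq (pi c : T^o) | c <- cs])).
  move=> cspan; apply/E'P; apply: span_min cspan => d dcs; apply/E'P/span_gen.
  exact: map_f.
apply: span_min => _ /mapP[d dcs ->]; apply/D'P/csP; exact: span_gen.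
Qed.

End FiniteAlgebra.

Section Artinian.
Variable k : comPzRingType.
Local Notation ideal := (submodule (k^o : lmodType k)).

Lemma ideal_mul (I : ideal) (a x : k) : I x -> I (a * x).
Proof. exact: (@in_subZ _ _ I a x). Qed.

Lemma artinian_min (Pr : ideal -> Prop) : artinian k -> (exists I, Pr I) ->
  exists I, Pr I /\ forall I' : ideal, Pr I' -> (forall x, I' x -> I x) ->
    forall x, I x -> I' x.
Proof.
move=> artk [I0 PI0]; apply: contrapT => nomin.
have next (I : {I | Pr I}) : exists I' : {I | Pr I},
    (forall x, sval I' x -> sval I x) /\ ~ (forall x, sval I x -> sval I' x).
  apply: contrapT => nI; apply: nomin; exists (sval I); split;
    first exact: (svalP I).
  by move=> I' PI' I'I; apply: contrapT => nII'; apply: nI;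
    exists (exist _ I' PI').
have [nx nxP] := choice next.
pose s i := iter i nx (exist _ I0 PI0).
have [||N NP] := artk (fun i => sval (s i) : k -> Prop).
- move=> i; split; first exact: in_sub0.
    by move=> x y; apply: in_subD.
  by move=> a x; apply: ideal_mul.
- move=> i x; by have [+ _] := nxP (s i); apply.
have [_] := nxP (s N); apply => x.
by have [_] := NP N.+1 (leqnSn N) x; apply.
Qed.

(** Choose A minimal among the ideals that contain an ideal which is not
    finitely generated. Then A itself is not finitely generated, but all smaller
    ideals are. Multiplication by c on A has image A or 0, because A is an
    extension of its image by its kernel; in the first case the descending chain
    of the ideals (c^i) shows that c acts invertibly on A. So A is a vector
    space over a field. A hyperplane of A is finitely generated, and therefore A
    is finitely generated, a contradiction. *)
Lemma artinian_noetherian : artinian k -> noetherian k.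
Proof.
move=> artk J0; apply: contrapT => nJ0.
pose noeth_in (A : ideal) := forall J : ideal, (forall x, J x -> A x) ->
  fin_gen J.
have [|A [nA minA]] := @artinian_min (fun A => ~ noeth_in A) artk.
  by exists J0 => h; apply: nJ0; apply: h.
have small (A' : ideal) : (forall x, A' x -> A x) ->
  ~ (forall x, A x -> A' x) -> noeth_in A'.
  by move=> A'A nAA'; apply: contrapT => nA'; apply: nAA'; apply: minA.
have nfgA : ~ fin_gen A.
  move=> fgA; apply: nA => J JA.
  have [AJ|nAJ] := pselect (forall x, A x -> J x); last exact: (small J JA nAJ).
  by have [xs xsP] := fgA; exists xs => x; rewrite -xsP; split; auto.
have mulc c : exists f : {linear k^o -> k^o}, forall x : k, f x = c * x.
  have lf : linear ((fun x : k => c * x) : (k^o : lmodType k) ->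
    (k^o : lmodType k)).
    by move=> a x y; rewrite -[LHS]/(c * (a * x + y)) mulrDr mulrCA.
  by exists (linear_of lf).
have dich c : (forall a, A a -> c * a = 0) \/
    (forall a, A a -> exists2 b, A b & a = c * b).
  have [f fE] := mulc c; pose g := lin_comp f (incl : {linear subm A -> k^o}).
  have imA x : im_sub g x -> A x.
    by move=> [a <-]; rewrite /= fE; apply/ideal_mul/inclP.
  have [AimA|nAim] := pselect (forall x, A x -> im_sub g x).
    right=> a /AimA[b ba]; exists (incl b); first exact: inclP.
    by rewrite -ba /= fE.
  have P0 : A 0 /\ f 0 = 0 by split; [apply: in_sub0 | apply: linear0].
  have PP a y z : A y /\ f y = 0 -> A z /\ f z = 0 ->
    A (a *: y + z) /\ f (a *: y + z) = 0.
    by move=> [Dy qy] [Dz qz]; split;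
      [apply: in_subP | rewrite linearP qy qz scaler0 addr0].
  pose Ac := Submodule P0 PP.
  have AcA x : Ac x -> A x by case.
  have [AAc|nAAc] := pselect (forall x, A x -> Ac x).
    by left=> a /AAc[_]; rewrite fE.
  case: nfgA; apply: (@fin_gen_ext _ _ _ f A (im_sub g)).
  - by move=> x /incl_onto[y yx]; exists y; rewrite /= yx.
  - by move=> y [x xy]; exists (incl x) => //; apply: inclP.
  - exact: (small _ imA nAim).
  - exact: (small _ AcA nAAc Ac).
have invert c : ~ (forall a, A a -> c * a = 0) -> exists d, forall a, A a ->
  a = d * c * a.
  move=> nc; have cA : forall a, A a -> exists2 b, A b
    & a = c * b by case: (dich c).
  have cnA i a : A a -> exists2 b, A b & a = c ^+ i * b.
    elim: i a => [|i IH] a Aa; first by exists a; rewrite // mul1r.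
    have [b Ab ->] := cA a Aa; have [b' Ab' ->] := IH b Ab.
    by exists b'; rewrite // mulrA -exprS.
  have [i||N NP] := artk (fun i x => exists y : k, x = c ^+ i * y).
  - split.
    + by exists 0; rewrite mulr0.
    + by move=> x y [u ->] [v ->]; exists (u + v); rewrite mulrDr.
    + by move=> a x [u ->]; exists (a * u); rewrite mulrCA.
  - by move=> i x [y ->]; exists (c * y); rewrite mulrA -exprSr.
  have [d dE] : exists d, c ^+ N = c ^+ N.+1 * d.
    by apply/(NP N.+1 (leqnSn N)); exists 1; rewrite mulr1.
  exists d => a /(cnA N)[b Ab ->].
  by rewrite {1}dE exprS -!mulrA [RHS]mulrCA; congr (_ * _); rewrite mulrCA.
have [x [Ax x0]] : exists x, A x /\ x <> 0.
  apply: contrapT => no; apply: nfgA; exists [::] => x; split=> [Ax|].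
    have -> : x = 0 by apply: contrapT => x0; apply: no; exists x.
    exact: in_sub0.
  by apply: span_min.
(* W is a hyperplane of A that does not contain x. *)
pose hyp (W : set k) := [/\ ~ W x, forall a, W a -> A a, W 0 &
  forall c a b, W a -> W b -> W (c * a + b)].
have [|W [PW maxW]] := @Zorn_bigcup k (fun W => W = set0 \/ hyp W).
  move=> F FP totF.
  have [[W0 [FW0 hW0]]|noW] := pselect (exists W, F W /\ hyp W); last first.
    left; apply/seteqP; split=> // y [W FW Wy].
    by case: (FP _ FW) => [W0|hW]; [rewrite W0 in Wy | case: noW; exists W].
  have hF W y : F W -> W y -> hyp W.
    by move=> FW Wy; case: (FP _ FW) => // W00; rewrite W00 in Wy.
  right; split.
  - by move=> [W FW Wx]; have [] := hF _ _ FW Wx.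
  - by move=> a [W FW Wa]; have [_ + _ _] := hF _ _ FW Wa; apply.
  - by exists W0 => //; case: hW0.
  - move=> c a b [W1 F1 W1a] [W2 F2 W2b].
    have [_ _ _ l1] := hF _ _ F1 W1a; have [_ _ _ l2] := hF _ _ F2 W2b.
    have [s|s] := totF _ _ F1 F2; first by exists W2 => //; apply: l2 => //;
      apply: s.
    by exists W1 => //; apply: l1 => //; apply: s.
have [nWx WA W0 WP] : hyp W.
  case: PW => // W00; case: (maxW (fun y => y = 0)); last first.
    by right; split=> // [a ->|c a b -> ->];
      [exact: in_sub0 | rewrite mulr0 addr0].
  by rewrite W00; split=> // s; apply: (s 0).
have [ws wsP] : fin_gen (Submodule (M := k^o) (in_sub := W) W0 WP).
  apply: (@small (@Submodule k k^o W W0 WP)) => // AW; exact/nWx/AW.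
apply: nfgA; exists (x :: ws) => y; split; last first.
  by apply: span_min => z; rewrite inE => /orP[/eqP ->//|zws];
    apply/WA/wsP/span_gen.
have Wspan z : W z -> span (fun y : k^o => y \in x :: ws) z.
  by move=> /wsP; apply: span_mono => u; rewrite inE orbC => ->.
move=> Ay; have [/Wspan//|nWy] := pselect (W y).
have [w [c [Ww xE]]] : exists w c, W w /\ x = w + c * y.
  apply: contrapT => no; apply:
    (maxW (fun z => exists w c, W w /\ z = w + c * y)).
    split=> [z Wz|s]; first by exists z, 0; rewrite mul0r addr0.
    by apply: nWy; apply: s; exists 0, 1; rewrite mul1r add0r.
  right; split=> [xin|a [w [c [Ww ->]]]||d a b [w [c [Ww ->]]]
    [w' [c' [Ww' ->]]]].
  - by apply: no.
  - by apply: in_subD; [apply: WA | apply: ideal_mul].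
  - by exists 0, 0; rewrite mul0r addr0.
  - exists (d * w + w'), (d * c + c'); split; first exact: (WP d w w').
    by rewrite mulrDr mulrDl mulrA addrACA ?mulrA.
have nc : ~ (forall a, A a -> c * a = 0).
  by move=> cA0; apply: nWx; rewrite xE cA0 // addr0.
have [d dP] := invert c nc.
have -> : y = d * x - d * w by rewrite xE mulrDr mulrA -dP // [d * w + y]addrC
  addrK.
apply: in_subB; first by apply: (@in_subZ _ _ _ d); apply: span_gen;
  apply: mem_head.
by apply/Wspan; have := WP d w 0 Ww W0; rewrite addr0.
Qed.

End Artinian.

(** * Injective dimension over noetherian rings *)

Section DirectSums.
Variables (R : pzRingType) (X : choiceType).

Lemma fin_gen_witness (M N : lmodType R) (D : submodule M) (xs : seq M)
    (f g : {linear subm D -> N}) :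
  (forall x, D x <-> span (fun y => y \in xs) x) ->
  (forall u, incl u \in xs -> f u = g u) -> forall u, f u = g u.
Proof.
move=> Dxs fg u; pose d := linear_of (linearP (f \- g)).
have : im_sub (lin_comp (incl : {linear subm D -> M})
    (incl : {linear subm (ker_sub d) -> subm D})) (incl u).
  have /Dxs := inclP u; apply: span_min => y yxs.
  have /Dxs/incl_onto[v vy] : span (fun y => y \in xs) y by apply: span_gen.
  have [|w wv] := incl_onto (D := ker_sub d) (x := v); last by exists w;
    rewrite /= wv.
  by rewrite /= fg ?vy // subrr.
move=> [w /incl_inj <-].
by apply/eqP; rewrite -subr_eq0; apply/eqP/(inclP w).
Qed.

Lemma dsum_im (A B : lmodType R) (h : {linear dsum X A -> dsum X B})
    (D : submodule B) (u : dsum X B) :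
  (forall x v, D v -> exists w, h w = dsingle x v) ->
    (forall x, D (coef x u)) ->
  exists w, h w = u.
Proof.
move=> hs uD; have [s us sP] := dsum_supp u; rewrite (dsum_decomp us sP).
by apply: (in_sub_sum (D := im_sub h)) => x _; apply: hs.
Qed.

Lemma dsum_map_ex (A B : lmodType R) (f : {linear A -> B}) :
  exists h : {linear dsum X A -> dsum X B},
    forall x u, coef x (h u) = f (coef x u).
Proof.
have [h hP] := dsum_univ
  (fun x => lin_comp (dsingle x) f : {linear A -> dsum X B}).
exists h => x u; move: u.
apply: (dsum_eq (h := lin_comp (coef x) h) (h' := lin_comp f (coef x))) =>
  y v /=.
by rewrite hP /= !coef_single; case: eqP => // _; rewrite linear0.
Qed.

Lemma ses_dsum (A B C : lmodType R) (i : {linear A -> B}) (q : {linear B -> C})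
  :
  ses i q -> exists (i' : {linear dsum X A -> dsum X B})
    (q' : {linear dsum X B -> dsum X C}), ses i' q'.
Proof.
move=> [inji sq ex]; have [i' i'P] := dsum_map_ex i;
  have [q' q'P] := dsum_map_ex q.
have single_map (U V : lmodType R) (f : {linear U -> V})
  (f' : {linear dsum X U -> dsum X V}) :
    (forall x u, coef x (f' u) = f (coef x u)) ->
    forall x v, f' (dsingle x v) = dsingle x (f v).
  move=> f'P x v; apply: coef_inj => y; rewrite f'P !coef_single.
  by case: eqP => // _; rewrite linear0.
exists i', q'; split=> [u v e|u|u].
- by apply: coef_inj => x; apply: inji; rewrite -!i'P e.
- apply: (dsum_im (D := im_sub q)) => x; last exact: sq.
  by move=> _ [v <-]; exists (dsingle x v); apply: single_map.
- split=> [qu0|[v <-]]; last first.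
    by apply: coef_inj => x; rewrite q'P i'P linear0; apply/ex;
      exists (coef x v).
  apply: (dsum_im (D := im_sub i)) => x.
    by move=> _ [v <-]; exists (dsingle x v); apply: single_map.
  by apply/ex; rewrite -q'P qu0 linear0.
Qed.

(** Bass. By Baer's criterion it is enough to extend f from a left ideal J. As J
    is finitely generated, the values of f have supports in a common finite set;
    the extension is made componentwise there and is 0 in the other components.
    *)
Lemma dsum_injective (I : lmodType R) : noetherian R ->
  injective_module I -> injective_module (dsum X I).
Proof.
move=> noR injI; apply: baer => J f; have [xs xsP] := noR J.
have yex x : exists y : I, (forall s, coef x (f s) = (incl s : R) *: y) /\
    ((forall s, coef x (f s) = 0) -> y = 0).
  have [f0|nf0] := pselect (forall s, coef x (f s) = 0).
    by exists 0; split=> // s; rewrite f0 scaler0.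
  have [h hP] := injI _ _ incl (lin_comp (coef x) f) (@incl_inj _ _ J).
  exists (h 1); split=> // s; rewrite -[LHS]hP -linearZ; congr (h _).
  by rewrite -[RHS]/((incl s : R) * 1) mulr1.
have [y yP] := choice yex.
have fs_y : fin_supp y.
  have [us usP] : exists us : seq (subm J), forall r, r \in xs ->
    exists2 u, u \in us & incl u = r.
    have xsJ r : r \in xs -> J r by move=> rxs; apply/xsP/span_gen.
    elim: (xs) xsJ => [|r rs IH] rsJ; first by exists [::].
    have [us usP] := IH (fun r' r's => rsJ r' (mem_behead (s := r :: rs) r's)).
    have [u ur] := incl_onto (rsJ r (mem_head _ _)); exists (u :: us) => r'.
    rewrite inE => /orP[/eqP ->|/usP[u' u's u'r]]; first by exists u;
      rewrite ?mem_head.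
    by exists u'; rewrite // inE u's orbT.
  have [s sP] : exists s : seq X, forall u, u \in us -> forall x, x \notin s ->
    coef x (f u) = 0.
    elim: (us) => [|u us' [s sP]]; first by exists [::].
    have [t _ tP] := dsum_supp (f u); exists (t ++ s) => u'.
    rewrite inE => /orP[/eqP ->|/sP u'P] x; rewrite mem_cat negb_or =>
      /andP[xt xs'].
      exact: tP.
    exact: u'P.
  exists s => x xs0; have [_] := yP x; apply.
  apply: (@fin_gen_witness _ _ J xs (lin_comp (coef x) f) (zero_map _ _)) =>
    [//|u uxs].
  have [u' u'us /incl_inj <-] := usP _ uxs; exact: sP.
have [Y YP] := dsum_of fs_y; exists Y => s; apply: coef_inj => x.
by rewrite linearZ YP; have [-> _] := yP x.
Qed.

Lemma dsum_id_le k (N : lmodType R) : noetherian R -> id_le N k ->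
  id_le (dsum X N) k.
Proof.
move=> noR; elim: k N => [|k IH] N.
  by move=> /id_le0 injN; apply/id_le0/dsum_injective.
have [i' [q' ex']] := ses_dsum (ses_cosyz N).
move=> idN; apply/(id_le_shift _ _ ex'); first
  exact/dsum_injective/inj_env_injective.
by apply: IH; apply/(id_le_shift _ _ (ses_cosyz N)) => //;
  apply: inj_env_injective.
Qed.

End DirectSums.

Section InjectiveDimensionOfRing.
Variable R : pzRingType.

Lemma id_le_retract k (N N' : lmodType R) (s : {linear N -> N'})
  (r : {linear N' -> N}) :
  cancel s r -> id_le N' k -> id_le N k.
Proof.
move=> sK idN' M; apply/ext_zero_syz; apply: (ext1_retract_r sK).
exact/ext_zero_syz.
Qed.

Lemma silp_regular k : noetherian R -> id_le R^o k -> silp_le R k.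
Proof.
move=> noR idR P projP; have [s sP] := projP _ _ _ (idfun : {linear P -> P})
  (free_cover_surj P).
apply: (id_le_retract (r := free_cover P) sP); exact: dsum_id_le.
Qed.

End InjectiveDimensionOfRing.

Section Adjoint.
Variables (R S : pzRingType) (phi : antimorphism R S) (psi : antimorphism S R).
Hypotheses (phiK : cancel phi psi) (psiK : cancel psi phi).

(** Both Ext groups are dual to the same Tor group. In degree 0 the two lifting
    problems along a presentation of B correspond under [flip]. *)
Lemma ext_zero_chr k (B : lmodType R) (X : lmodType S) :
  ext_zero k B (chr phi X) <-> ext_zero k X (chr psi B).
Proof.
elim: k B => [|k IH] B; have ex := ses_syz B; have exc := ses_chr psi ex;
  have projF := free_projective (R := R) (X := B);
  have injF := chr_projective phiK psiK projF; last first.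
  by rewrite -(ext_zero_proj _ _ projF ex) -(ext_zero_inj _ _ injF exc).
rewrite /ext_zero /= (ext1_proj _ projF ex) (ext1_inj _ injF exc).
split=> lift f.
  have [g gP] := lift (flip phiK f); exists (flip psiK g) => x;
    apply: ev_inj => b.
  by rewrite chr_mapE flipE gP flipE.
have [g gP] := lift (flip psiK f); exists (flip phiK g) => b;
  apply: ev_inj => x.
by rewrite flipE -chr_mapE gP flipE.
Qed.

End Adjoint.

Section Bidual.
Variables (R S : pzRingType) (phi : antimorphism R S) (psi : antimorphism S R).
Hypotheses (phiK : cancel phi psi) (psiK : cancel psi phi).
Hypothesis noR : noetherian R.
Local Notation chr2 M := (chr phi (chr psi M)).

Lemma fin_gen_tuple (M : lmodType R) (D : submodule M) : fin_gen D ->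
  exists p (r : 'I_p -> subm D), forall (N : lmodType R)
    (f g : {linear subm D -> N}),
    (forall i, f (r i) = g (r i)) -> forall u, f u = g u.
Proof.
move=> [xs xsP].
have mem i : D (tnth (in_tuple xs) i) by apply/xsP/span_gen/mem_tnth.
have [r rP] := choice (fun i => incl_onto (mem i)).
exists (size xs), r => N f g fg; apply: (fin_gen_witness xsP) => u uxs.
have [i iu] := tnthP (in_tuple xs) _ uxs.
by have -> : u = r i by apply: incl_inj; rewrite rP.
Qed.

(** To extend f from J = (rho_1, ..., rho_p) means to solve rho_i y = f (r_i).
    There is a solution h 1 in M^++. If there were none in M, a character c of
    M^p would kill all (rho_i y) but not (f (r_i)); but then the sum of the
    rho_i c_i vanishes in M^+, and evaluating h 1 at it gives a contradiction.
    *)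
Lemma bidual_injective_inv (M : lmodType R) :
  injective_module (chr2 M) -> injective_module M.
Proof.
move=> injMM; apply: baer => J f.
have [p [r rP]] := fin_gen_tuple (noR J).
have [h hP] := injMM _ _ incl (lin_comp (bidual phiK M) f) (@incl_inj _ _ J).
pose rho i : R := incl (r i).
have hrho i : bidual phiK M (f (r i)) = rho i *: h 1.
  by rewrite -[LHS]hP -linearZ; congr (h _); rewrite -[RHS]/(rho i * 1) mulr1.
suff [y yP] : exists y, forall i, f (r i) = rho i *: y.
  exists y => s; apply: (rP _ f (lin_comp (linear_of (linear_eval y)) incl)) =>
    i.
  exact: yP.
apply: contrapT => noy.
pose H (z : 'I_p -> M) := exists y, forall i, z i = rho i *: y.
have H0 : H 0 by exists 0 => i; rewrite scaler0.
have HB z z' : H z -> H z' -> H (z - z').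
  move=> [y zy] [y' zy']; exists (y - y') => i.
  by rewrite -[LHS]/(z i - z' i) zy zy' scalerBr.
have [chi [chiB chiH]] := char_sep H0 HB (x := fun i => f (r i)) noy; apply.
have [c cP] := char_split psi chiB; rewrite cP.
under eq_bigr => i _ do rewrite -(bidualE phiK) hrho evZ.
transitivity (ev (h 1) (\sum_i phi (rho i) *: c i)); first by rewrite raddf_sum.
rewrite (_ : \sum_i phi (rho i) *: c i = 0) ?raddf0 //.
apply: ev_inj => y; rewrite chr_sum ev0.
under eq_bigr => i _ do rewrite evZ phiK.
by rewrite -(cP (fun i => rho i *: y)) chiH //; exists y.
Qed.

(** Let s_1, ..., s_q generate the relations between the generators rho_i of J.
    Since M is injective, M -> M^p -> M^q is exact at M^p ([solve]), and
    dualizing this sequence twice preserves exactness: a character of M^p that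
    kills the rho_i y factors through M^q, and the relations [FE] satisfied by
    the values of f dispose of it. *)
Lemma bidual_injective (M : lmodType R) :
  injective_module M -> injective_module (chr2 M).
Proof.
move=> injM; apply: baer => J f.
have [p [r rP]] := fin_gen_tuple (noR J).
pose rho i : R := incl (r i).
pose t : {linear fpow R p -> R^o} := lin_comb (fun i => rho i : R^o).
have [q [s sP]] := fin_gen_tuple (noeth_pow (n := p) noR (ker_sub t)).
have solve (z : 'I_p -> M) :
    (forall l, \sum_i (incl (s l) i : R) *: z i = 0) ->
      exists y, forall i, z i = rho i *: y.
  move=> sz.
  have [t' t'P] := corestrict (f := t) (D := im_sub t)
    (fun v => ex_intro _ v erefl).
  have [||g gP] := @factor_surj _ _ _ _ t' (lin_comb z).
  - by move=> w; have [v vw] := inclP w; exists v; apply: incl_inj; rewrite t'P.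
  - move=> v /(congr1 incl); rewrite t'P linear0 =>
    /(@incl_onto _ _ (ker_sub t))[u <-].
    exact: (sP _ (lin_comp (lin_comb z) incl) (zero_map _ _)).
  have [h hP] := injM _ _ incl g (@incl_inj _ _ (im_sub t)).
  exists (h 1) => i; rewrite -[LHS]lin_comb_unit -gP -hP t'P lin_comb_unit
    -linearZ.
  by rewrite -[_ *: _]/(rho i * 1) mulr1.
have FE l : \sum_i (incl (s l) i : R) *: f (r i) = 0.
  rewrite -[RHS](linear0 f);
    transitivity (f (\sum_i (incl (s l) i : R) *: r i)).
    by rewrite [RHS]linear_sum; apply: eq_bigr => i _; rewrite [RHS]linearZ.
  congr (f _); apply: incl_inj; rewrite [LHS]linear_sum linear0
    -[RHS](inclP (s l)).
  by apply: eq_bigr => i _; rewrite [LHS]linearZ.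
pose T (c : 'I_p -> chr psi M) := \sum_i phi (rho i) *: c i.
pose G (c : 'I_p -> chr psi M) := \sum_i ev (f (r i)) (c i).
have TB : zmod_morphism T.
  by move=> c c'; rewrite /T -sumrB; apply: eq_bigr => i _; rewrite -scalerBr.
have GB : zmod_morphism G.
  by move=> c c'; rewrite /G -sumrB; apply: eq_bigr => i _; rewrite -ev_morph.
have [c Tc0|Y YB YP] := char_factor TB GB.
  pose chi (z : 'I_p -> M) := \sum_i ev (c i) (z i).
  have chiB : zmod_morphism chi.
    by move=> z z'; rewrite /chi -sumrB; apply: eq_bigr => i _;
      rewrite -ev_morph.
  pose sg (z : 'I_p -> M) : 'I_q -> M := fun l =>
    \sum_i (incl (s l) i : R) *: z i.
  have sgB : zmod_morphism sg.
    move=> z z'; apply/funext => l; rewrite -[RHS]/(sg z l - sg z' l) /sg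
      -sumrB.
    by apply: eq_bigr => i _; rewrite -scalerBr.
  have [z sz0|om omB omP] := char_factor sgB chiB.
    have [l|y yP] := solve z; first by rewrite -[LHS]/(sg z l) sz0.
    transitivity (ev (T c) y); last by rewrite Tc0 ev0.
    by rewrite chr_sum; apply: eq_bigr => i _; rewrite evZ phiK yP.
  have [w wP] := char_split psi omB.
  have cE i : c i = \sum_l phi (incl (s l) i) *: w l.
    apply: ev_inj => x; transitivity (chi (unit_fun i x)).
      rewrite /chi (unit_fun_sum (F := fun k y => ev (c k) y)) // => k;
        exact: raddf0.
    rewrite -omP wP chr_sum; apply: eq_bigr => l _; rewrite evZ phiK;
      congr (ev _ _).
    rewrite /sg (unit_fun_sum (F := fun k y => (incl (s l) k : R) *: y)) // =>
      k.
    exact: scaler0.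
  rewrite /G; under eq_bigr => i _ do rewrite cE raddf_sum.
  rewrite exchange_big big1 // => l _ /=.
  transitivity (ev (\sum_i (incl (s l) i : R) *: f (r i)) (w l));
    last by rewrite FE ev0.
  rewrite (big_morph (fun g : chr2 M => ev g (w l)) (fun g g' => evD g g' (w l))
    (ev0 _ _)).
  by apply: eq_bigr => i _; rewrite evZ.
have [y yP] := chr_of phi YB; exists y.
apply: (rP _ f (lin_comp (linear_of (linear_eval (y : chr2 M))) incl)) => i.
apply: ev_inj => x; rewrite /= evZ yP.
transitivity (Y (T (unit_fun i x))).
  rewrite YP /G (unit_fun_sum (F := fun k y => ev (f (r k)) y)) // => k;
    exact: raddf0.
congr Y; rewrite /T (unit_fun_sum (F := fun k y => phi (rho k) *: y)) // => k.
exact: scaler0.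
Qed.

Lemma bidual_id_le k (M : lmodType R) : id_le (chr2 M) k <-> id_le M k.
Proof.
elim: k M => [|k IH] M.
  rewrite !id_le0; split; [exact: bidual_injective_inv | exact:
    bidual_injective].
have ex := ses_cosyz M; have injI := inj_env_injective (M := M).
rewrite -(id_le_shift _ injI ex) -IH; symmetry.
apply: id_le_shift (ses_chr phi (ses_chr psi ex)); exact: bidual_injective.
Qed.

End Bidual.

(** * The two sides of an Artin algebra *)

Section TwoSides.
Variables (R S : pzRingType) (phi : antimorphism R S) (psi : antimorphism S R).
Hypotheses (phiK : cancel phi psi) (psiK : cancel psi phi).

(** S^+ is an injective R-module, so Ext_R^(k+1)(S^+, X^+) = 0, that is
    Ext_S^(k+1)(X, S^++) = 0, for all X. *)
Lemma spli_id_le_opposite k : noetherian S -> spli_le R k -> id_le S^o k.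
Proof.
move=> noS splik; apply/(bidual_id_le psiK noS) => X.
apply/(ext_zero_chr phiK psiK); apply: splik.
exact: (chr_projective psiK phiK (@regular_projective S)).
Qed.

(** E is a direct summand of F^+ for a free R-module F, and F^++ has the
    injective dimension of F. *)
Lemma silp_injective_fd n (E : lmodType S) : noetherian R -> silp_le R n ->
  injective_module E -> id_le (chr phi E) n.
Proof.
move=> noR silpn injE X; pose F := free R (chr phi E).
pose e := lin_comp (chr_map psi (free_cover (chr phi E))) (bidual psiK E).
have inje : injective e.
  move=> x y /= /(chr_map_inj psi (free_cover_surj (chr phi E))).
  exact: bidual_inj.
have [r rP] := injE _ _ e (idfun : {linear E -> E}) inje.
have idF : id_le (chr phi (chr psi F)) n.
  by apply/(bidual_id_le phiK noR)/silpn; apply: free_projective.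
apply/(ext_zero_chr psiK phiK); apply: (ext1_retract_l rP).
by apply/(ext_zero_chr psiK phiK).
Qed.

End TwoSides.

(** From R to S the inequality of [spli_id_le_opposite] suffices; the converse
    applies it to S, whose injective modules have finite flat dimension by
    [silp_injective_fd]. *)
Lemma noetherian_symmetry (R S : pzRingType) (phi : antimorphism R S)
    (psi : antimorphism S R) n : cancel phi psi -> cancel psi phi ->
  noetherian R -> noetherian S ->
  (forall E : lmodType R, injective_module E -> exists m, id_le (chr psi E) m)
    ->
  silp_le R n -> forall k, id_le R^o k <-> id_le S^o k.
Proof.
move=> phiK psiK noR noS fdE silpn k; split=> idk.
  apply: (spli_id_le_opposite phiK psiK noS).
  exact: (spli_le_of_silp_le phiK psiK fdE (silp_regular noR idk)).
apply: (spli_id_le_opposite psiK phiK noR).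
apply: (spli_le_of_silp_le psiK phiK _ (silp_regular noS idk)) => E injE.
by exists n; apply: (silp_injective_fd phiK psiK noR silpn).
Qed.

Lemma artin_algebra_noetherian (R : pzRingType) :
  artin_algebra R -> noetherian R /\ noetherian R^c.
Proof.
move=> [k [f [/artinian_noetherian nok cf [n [g gP]]]]].
pose pi (c : fpow k n) : R := \sum_i f (c i) * g i.
have piB : zmod_morphism pi.
  move=> c d; rewrite /pi -sumrB; apply: eq_bigr => i _.
  by rewrite -mulrBl -rmorphB.
have piZ a (c : fpow k n) : pi (a *: c) = f a * pi c.
  rewrite /pi mulr_sumr; apply: eq_bigr => i _.
  by rewrite mulrA -rmorphM.
have spi : surj pi by move=> x; have [c ->] := gP x; exists c.
split; first exact: (noetherian_finite piB piZ spi nok).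
apply: (@noetherian_finite k R^c f n pi piB _ spi nok) => a c.
by rewrite piZ cf.
Qed.

Theorem proposition3p15 (R : pzRingType)
    (hflat : forall E : lmodType R, injective_module E -> finite_flat_dim E)
    (hsilp : exists n : nat, silp R = Some n) :
  silp R = spli R /\ (artin_algebra R -> gorenstein_symmetry R).
Proof.
split; first exact: silp_eq_spli.
move=> /artin_algebra_noetherian[noR noRc]; apply: least_ext => k.
rewrite !injective_coresolution.
have [n] := hsilp; rewrite silpE => /leastP[silpn _].
apply: (@noetherian_symmetry R R^c (to_conv R) (of_conv R) n) =>
  // E /hflat[m res].
by exists m; apply: flat_resolution_id_le.
Qed.
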